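(* Let $A_1,\dots,A_m\in\mathbb{R}^{n\times n}$. The switched linear system $$\dot x=A_ix,\qquad i\in\{1,\dots,m\},$$ is asymptotically stable under arbitrary switching if and only if there exists a common homogeneous polynomial Lyapunov function $W$ such that $W$ is a sum of squares and, for each $i=1,\dots,m$, the polynomial $$-\dot W_i(x)=-\langle\nabla W(x),A_ix\rangle$$ is a sum of squares, where the polynomials $W$ and $-\dot W_i$ ($i=1,\dots,m$) are all positive definite.
   Context: A homogeneous polynomial $p$ is positive definite if $p(x)>0$ for all $x\ne0$; it is a sum of squares if it is a finite sum of squares of real polynomials. Asymptotic stability under arbitrary switching of the switched linear system is understood as asymptotic stability of the origin for the linear differential inclusion $\dot x\in \mathrm{co}\{A_1,\dots,A_m\}\,x$, where $\mathrm{co}$ denotes the convex hull (all absolutely continuous solutions being considered). *)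

(* Defs.v *)
From mathcomp Require Import all_boot all_order all_algebra.
From mathcomp Require mpoly.

Set Implicit Arguments.
Unset Strict Implicit.
Unset Printing Implicit Defensive.

Import Order.TTheory GRing.Theory Num.Theory.
Local Open Scope ring_scope.

(* The notations of mpoly and of mathcomp-analysis cannot be active at the same
   time, so mpoly is imported inside this module only. *)
Module RealForms.
Import mpoly.

Section RealForms.
Variables (R : realFieldType) (n : nat).
Implicit Types (p W : {mpoly R[n]}) (A : 'M[R]_n).

Definition homogeneous p : Prop := exists d : nat, p \is d.-homog.

Definition positive_definite p : Prop :=
  forall x : 'cV[R]_n, x != 0 -> 0 < p.@[fun k => x k 0].

Definition sum_of_squares p : Prop :=
  exists s : seq {mpoly R[n]}, p = \sum_(q <- s) q ^+ 2.

(* The polynomial <grad W(x), A x>. *)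
Definition lie_derivative A W : {mpoly R[n]} :=
  \sum_(k < n) W^`M(k) * (\sum_(l < n) A k l *: 'X_l).

End RealForms.
End RealForms.
Export RealForms.

From mathcomp Require Import all_classical all_reals all_analysis.
Import numFieldNormedType.Exports.

Local Open Scope classical_set_scope.

(* Absolute continuity on the segment [a, b]. *)
Definition absolutely_continuous_on (R : realType) (V : normedModType R)
    (a b : R) (f : R -> V) : Prop :=
  forall e : R, 0 < e -> exists2 d : R, 0 < d &
    forall (N : nat) (u v : 'I_N -> R),
      (forall k, [/\ a <= u k, u k <= v k & v k <= b]) ->
      trivIset setT (fun k => `]u k, v k[) ->
      \sum_(k < N) (v k - u k) < d ->
      \sum_(k < N) `|f (v k) - f (u k)| < e.

Section SwitchedLinearSystem.
Variables (R : realType) (n m : nat).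
Implicit Types (A : 'I_m -> 'M[R]_n) (x : R -> 'cV[R]_n).

Definition matrix_convex_hull A : set 'M[R]_n :=
  [set B | exists c : 'I_m -> R,
     [/\ forall i, 0 <= c i, \sum_(i < m) c i = 1 &
         B = \sum_(i < m) c i *: A i]].

(* Solutions on [0, +oo[ of the differential inclusion x' \in co{A_i} x; the
   values of x at negative times are irrelevant. *)
Definition inclusion_solution A x : Prop :=
  (forall T : R, 0 < T -> absolutely_continuous_on 0 T x) /\
  {ae @lebesgue_measure R, forall t : R, 0 < t ->
     exists2 B, matrix_convex_hull A B & is_derive t 1 x (B *m x t)}.

Definition lyapunov_stable A : Prop :=
  forall e : R, 0 < e -> exists2 d : R, 0 < d &
    forall x, inclusion_solution A x -> `|x 0| < d ->
      forall t : R, 0 <= t -> `|x t| < e.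

Definition locally_attractive A : Prop :=
  exists2 d : R, 0 < d &
    forall x, inclusion_solution A x -> `|x 0| < d ->
      x t @[t --> +oo] --> (0 : 'cV[R]_n).

Definition asymptotically_stable A : Prop :=
  lyapunov_stable A /\ locally_attractive A.

End SwitchedLinearSystem.

(* Main.v *)
Require Import Defs.
From HB Require Import structures.
From mathcomp Require Import all_boot all_order all_algebra.
From mathcomp Require mpoly.
Import (canonicals, coercions) mpoly.
From mathcomp Require Import ring lra.

(** Why the theorem holds.

    A Lyapunov polynomial gives stability.  A positive definite form [W] of
    degree [d > 0] is comparable to [|x|^d], and so are the forms [-W'_i]; by
    convexity [W' <= - lambda W] along every direction of the inclusion.  Hence
    [(1 + lambda t) W(x(t))] has a nonpositive derivative at almost every time
    of a solution [x], and it is absolutely continuous, so it is nonincreasing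
    ([ac_nonincreasing], [solution_decay]).  Therefore [|x(t)|^d] is at most a
    constant times [|x(0)|^d / (1 + lambda t)], which is both stability and
    attractivity.

    Conversely, asymptotic stability produces a polynomial in three steps.

    Uniformity.  Let [G] be the set of matrices [M] such that a solution can
    steer every vector [v] to [M v] in unit time.  An infinite product of
    elements of [G] is followed by a solution, so stability bounds all finite
    products and attractivity makes all infinite products tend to zero.  Total
    boundedness of bounded sets in finite dimension turns this into a uniform
    statement: all sufficiently long products are smaller than any prescribed
    constant ([uniform_contraction]).  Working with sets of products, and not
    with limits of trajectories, avoids any compactness of the set of solutions.

    A polyhedral norm.  Take a small step [h] and let [l] range over the rows of
    all short products of the matrices [exp (h A_i)], with weights that grow
    slowly with the length.  Multiplying a row by [exp (h A_i)] gives a longer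
    row, of smaller relative weight, or a row of a long and hence small product.
    So [l (1 + h A_i)], which differs from [l exp (h A_i)] by [O(h^2)], is a
    combination of the rows whose coefficients have absolute sum less than one
    ([polyhedral_contraction_lyapunov]).  The norm [max |l x|] is thus
    contracted by Euler steps, and the contraction is witnessed by coefficients.

    Smoothing.  Replace the maximum by [W = sum (l x)^D] with [D] a large power
    of two.  The coefficients above write each [-W'_i] as a combination, with
    nonnegative coefficients, of powers [(l x)^D] and of gaps in the weighted
    arithmetic-geometric inequality [D a^(D-1) b <= (D-1) a^D + b^D], which are
    explicit sums of squares ([Forms.sos_amgm_gap],
    [Forms.polyhedral_lyapunov_sos]).  This yields positivity and the sums of
    squares at once. *)

Set Implicit Arguments.
Unset Strict Implicit.
Unset Printing Implicit Defensive.

Import Order.TTheory GRing.Theory Num.Theory.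
Local Open Scope ring_scope.

(** * Sums of squares and even powers of linear forms *)

Module Forms.
Import mpoly.

Section Induction.
Variables (n : nat) (R : comNzRingType).

(** Evaluation, differentiation and local Lipschitz bounds are compatible with
    sums and products, so this is the induction by which they are proved. *)
Lemma mpoly_alg_ind (P : {mpoly R[n]} -> Prop) :
  (forall c, P c%:MP) -> (forall k, P 'X_k) ->
  (forall p q, P p -> P q -> P (p + q)) ->
  (forall p q, P p -> P q -> P (p * q)) ->
  forall p, P p.
Proof.
move=> PC PX PD PM p; elim/mpolyind: p => [|c m p _ _ Pp]; first exact: (PC 0).
apply: (PD) => //; rewrite -mul_mpolyC; apply: (PM); first exact: PC.
rewrite mpolyXE_id; apply: (big_ind P) => [||i _]; [exact: (PC 1)|exact: (PM)|].
elim: (m i) => [|d IH]; first exact: (PC 1).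
by rewrite exprS; apply: PM.
Qed.

End Induction.

Section AmGm.
Variable S : comNzRingType.
Implicit Types a b : S.

(** The gap in the weighted arithmetic-geometric inequality for [a^D], taken
    [D - 1] times, and [b^D]. *)
Definition amgm_gap (D : nat) a b : S :=
  D.-1%:R * a ^+ D + b ^+ D - D%:R * (a ^+ D.-1 * b).

Lemma amgm_gap2 a b : amgm_gap 2 a b = (a - b) ^+ 2.
Proof. by rewrite /amgm_gap /= expr1; ring. Qed.

(** The recursion that makes the gap a sum of squares for [D] a power of two:
    doubling [D] multiplies the gap by [2 a^D], an even power, and adds a square. *)
Lemma amgm_gap_double D a b : (0 < D)%N ->
  amgm_gap (D + D) a b =
    a ^+ D * amgm_gap D a b + a ^+ D * amgm_gap D a b + (a ^+ D - b ^+ D) ^+ 2.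
Proof.
case: D => // D _; rewrite /amgm_gap addSn /= expr2 !(exprS, exprD) -!natr1 natrD -!natr1.
by move: (a ^+ D) (b ^+ D) => x y; ring.
Qed.

End AmGm.

Section SumsOfSquares.
Variables (n : nat) (R : rcfType).
Implicit Types p q : {mpoly R[n]}.

Lemma sos_sqr q : sum_of_squares (q ^+ 2).
Proof. by exists [:: q]; rewrite big_seq1. Qed.

Lemma sosD p q : sum_of_squares p -> sum_of_squares q -> sum_of_squares (p + q).
Proof. by move=> [s ->] [t ->]; exists (s ++ t); rewrite big_cat. Qed.

Lemma sos_sum (I : Type) (r : seq I) (F : I -> {mpoly R[n]}) :
  (forall i, sum_of_squares (F i)) -> sum_of_squares (\sum_(i <- r) F i).
Proof.
move=> sosF; elim: r => [|i r IH]; first by exists [::]; rewrite !big_nil.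
by rewrite big_cons; apply: sosD.
Qed.

Lemma sosZ (c : R) p : 0 <= c -> sum_of_squares p -> sum_of_squares (c *: p).
Proof.
move=> c0 [s ->]; exists [seq Num.sqrt c *: q | q <- s].
rewrite big_map scaler_sumr; apply: eq_bigr => q _.
by rewrite exprZn sqr_sqrtr.
Qed.

Lemma sos_sqrM q p : sum_of_squares p -> sum_of_squares (q ^+ 2 * p).
Proof.
move=> [s ->]; exists [seq q * r | r <- s].
by rewrite big_map mulr_sumr; apply: eq_bigr => r _; rewrite exprMn.
Qed.

Lemma sos_eval_ge0 p v : sum_of_squares p -> 0 <= p.@[v].
Proof.
move=> [s ->]; rewrite raddf_sum; apply: sumr_ge0 => q _.
by rewrite /= rmorphXn; exact: sqr_ge0.
Qed.

Lemma sos_amgm_gap r p q : sum_of_squares (amgm_gap (2 ^ r.+1) p q).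
Proof.
elim: r => [|r IH].
  rewrite expn1 amgm_gap2.
  exact: sos_sqr.
have D0 : (0 < 2 ^ r.+1)%N by rewrite expn_gt0.
have -> : amgm_gap (2 ^ r.+2) p q = (p ^+ (2 ^ r)) ^+ 2 * amgm_gap (2 ^ r.+1) p q
    + (p ^+ (2 ^ r)) ^+ 2 * amgm_gap (2 ^ r.+1) p q
    + (p ^+ (2 ^ r.+1) - q ^+ (2 ^ r.+1)) ^+ 2.
  rewrite -exprM -expnSr (expnS 2 r.+1) mul2n -addnn.
  by rewrite -amgm_gap_double // expn_gt0.
by apply: sosD; [apply: sosD; exact: sos_sqrM | exact: sos_sqr].
Qed.

End SumsOfSquares.

Section LieDerivative.
Variables (n : nat) (R : realFieldType).
Implicit Types (p q : {mpoly R[n]}) (A : 'M[R]_n) (v : 'rV[R]_n).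

Definition linear_form v : {mpoly R[n]} := \sum_(k < n) v 0 k *: 'X_k.

Lemma mderivXU j k : ('X_j)^`M(k) = (j == k)%:R%:MP :> {mpoly R[n]}.
Proof.
rewrite mderivX mnm1E; case: eqVneq => [->|_]; last by rewrite scale0r.
by rewrite scale1r -{1}[U_(k)%MM]add0m addmK mpolyX0.
Qed.

Lemma linear_form_is_linear : linear linear_form.
Proof.
move=> a u v; rewrite /linear_form scaler_sumr -big_split; apply: eq_bigr => k _.
by rewrite !mxE scalerDl scalerA.
Qed.

HB.instance Definition _ :=
  GRing.isLinear.Build R 'rV[R]_n {mpoly R[n]} _ linear_form
    linear_form_is_linear.

Lemma linear_form_homog v : linear_form v \is 1.-homog.
Proof.
apply: rpred_sum => k _; apply: rpredZ.
by rewrite dhomogX /= mdeg1.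
Qed.

Lemma linear_form_eval v (x : 'cV[R]_n) :
  (linear_form v).@[fun k => x k 0] = (v *m x) 0 0.
Proof.
rewrite raddf_sum mxE; apply: eq_bigr => k _.
by rewrite /= mevalZ mevalXU.
Qed.

Lemma lie_derivative_eval A p (x : 'cV[R]_n) :
  (lie_derivative A p).@[fun k => x k 0] =
  \sum_(k < n) p^`M(k).@[fun k => x k 0] * (A *m x) k 0.
Proof.
rewrite raddf_sum; apply: eq_bigr => k _; rewrite /= mevalM; congr (_ * _); rewrite raddf_sum mxE.
by apply: eq_bigr => j _; rewrite /= mevalZ mevalXU.
Qed.

Lemma lie_derivative_is_linear A : linear (lie_derivative A).
Proof.
move=> a p q; rewrite /lie_derivative scaler_sumr -big_split; apply: eq_bigr => k _.
by rewrite mderivD mderivZ mulrDl scalerAl.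
Qed.

HB.instance Definition _ A :=
  GRing.isLinear.Build R {mpoly R[n]} {mpoly R[n]} _ (lie_derivative A)
    (lie_derivative_is_linear A).

Lemma lie_derivativeM A p q :
  lie_derivative A (p * q) = lie_derivative A p * q + p * lie_derivative A q.
Proof.
rewrite /lie_derivative mulr_suml mulr_sumr -big_split; apply: eq_bigr => k _.
by rewrite mderivM mulrDl mulrAC mulrA.
Qed.

Lemma lie_derivativeX A p d :
  lie_derivative A (p ^+ d) = (p ^+ d.-1 * lie_derivative A p) *+ d.
Proof.
elim: d => [|d IH].
  by rewrite mulr0n expr0 /lie_derivative big1 // => k _; rewrite mderivC mul0r.
rewrite exprS lie_derivativeM IH mulrnAr mulrA mulrC mulrS.
by case: d {IH} => [|d]; rewrite ?mulr0n // -exprS mulrC.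
Qed.

Lemma lie_derivative_linear_form A v :
  lie_derivative A (linear_form v) = linear_form (v *m A).
Proof.
have dv k : (linear_form v)^`M(k) = (v 0 k)%:MP.
  rewrite /linear_form raddf_sum (bigD1 k) //= big1 ?addr0 => [|j /negbTE jk].
    by rewrite mderivZ mderivXU eqxx alg_mpolyC.
  by rewrite mderivZ mderivXU jk scaler0.
rewrite /lie_derivative; under eq_bigr do rewrite dv mulr_sumr.
rewrite exchange_big; apply: eq_bigr => j _.
rewrite mxE scaler_suml; apply: eq_bigr => k _.
by rewrite mul_mpolyC scalerA.
Qed.

End LieDerivative.

Section Polyhedral.
Variables (n m : nat) (R : archiRcfType) (A : 'I_m -> 'M[R]_n).

(** The term [- c a^(D-1) b], of unknown sign, is traded for even powers: the
    sign of [c] is absorbed by [b], and disappears from [b^D]. *)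
Lemma amgm_gap_signed D (c : R) (a b : {mpoly R[n]}) : ~~ odd D ->
  `|c| *: amgm_gap D a (Num.sg c *: b) =
  (D.-1%:R * `|c|) *: a ^+ D + `|c| *: b ^+ D - D%:R *: (c *: (a ^+ D.-1 * b)).
Proof.
move=> /negbTE evD; rewrite /amgm_gap !mulr_natl -!scaler_nat.
rewrite scalerBr scalerDr; congr (_ + _ - _).
- by rewrite scalerA mulr_natr.
- have [->|c0] := eqVneq c 0; first by rewrite normr0 !scale0r.
  by rewrite exprZn sgr_odd // evD scale1r.
- by rewrite -scalerAr !scalerA mulrAC [_ * Num.sg c]mulrC -numEsg mulrC.
Qed.

Variables (I : finType) (l : I -> 'rV[R]_n) (h : R) (p : 'I_m -> I -> I -> R).
Hypotheses (h_gt0 : 0 < h)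
  (l_contract : forall i j,
     l j *m (1%:M + h *: A i) = \sum_(k : I) p i j k *: l k)
  (p_lt1 : forall i j, \sum_(k : I) `|p i j k| < 1)
  (l_span : forall x : 'cV[R]_n, (forall j, l j *m x = 0) -> x = 0).

Let Y j := linear_form (l j).
Let W D : {mpoly R[n]} := \sum_(j : I) Y j ^+ D.
Let c D i j : R :=
  D%:R - (D.-1%:R * \sum_(k : I) `|p i j k| + \sum_(k : I) `|p i k j|).

Let lieY i j :
  lie_derivative (A i) (Y j) = h^-1 *: (\sum_(k : I) p i j k *: Y k - Y j).
Proof.
rewrite lie_derivative_linear_form.
have -> : l j *m A i = h^-1 *: (\sum_(k : I) p i j k *: l k - l j).
  rewrite -l_contract mulmxDr mulmx1 -scalemxAr addrC addKr scalerA.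
  by rewrite mulVf ?gt_eqF // scale1r.
rewrite linearZ linearB linear_sum /=; congr (_ *: (_ - _)).
by apply: eq_bigr => k _; rewrite linearZ.
Qed.

(** The heart of the construction: each product [Y_j^(D-1) Y_k] is replaced by
    a gap and by the powers [Y_j^D] and [Y_k^D], whose total coefficient is [c].
    In [c] the row sums of [|p|] have weight [D - 1], the column sums weight 1. *)
Let decrease D i : ~~ odd D -> - lie_derivative (A i) (W D) =
  h^-1 *: (\sum_(j : I) \sum_(k : I)
             `|p i j k| *: amgm_gap D (Y j) (Num.sg (p i j k) *: Y k)
           + \sum_(j : I) c D i j *: Y j ^+ D).
Proof.
move=> evD; rewrite [lie_derivative _ _]linear_sum -sumrN /=.
under eq_bigr => j _.
  rewrite lie_derivativeX lieY -scalerAr -scaler_nat scalerA mulrC -scalerA -scalerN.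
  over.
rewrite -scaler_sumr; congr (_ *: _).
under [in RHS]eq_bigr do under eq_bigr do rewrite amgm_gap_signed //.
rewrite [X in _ = X + _](eq_bigr (fun j => (D.-1%:R * \sum_(k : I) `|p i j k|) *: Y j ^+ D +
    \sum_(k : I) `|p i j k| *: Y k ^+ D -
    D%:R *: (Y j ^+ D.-1 * \sum_(k : I) p i j k *: Y k))); last first.
  move=> j _; rewrite sumrB big_split /= -scaler_suml -mulr_sumr -scaler_sumr.
  congr (_ + _ - _ *: _); rewrite mulr_sumr; apply: eq_bigr => k _.
  by rewrite scalerAr.
rewrite sumrB big_split /= exchange_big /= addrAC -!big_split /= -sumrB.
apply: eq_bigr => j _.
rewrite -scaler_suml -scalerDl mulrBr scalerBr opprB.
rewrite -[_ + c D i j *: _]scalerDl /c addrC subrKC addrC; congr (_ + _).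
by case: D {evD} => [|D]; rewrite ?scale0r // -exprSr.
Qed.

(** The row sums are less than one by contraction; the column sums are
    arbitrary but do not grow with [D], so a large [D] outweighs them. *)
Let exponent_exists : exists r, forall i j, 0 < c (2 ^ r.+1) i j.
Proof.
pose u i j := (\sum_(k : I) `|p i k j|) / (1 - \sum_(k : I) `|p i j k|).
have u_ge0 i j : 0 <= u i j.
  by rewrite divr_ge0 ?sumr_ge0 // subr_ge0 ltW.
pose B := \sum_i \sum_j u i j.
have [N BN] : exists N : nat, B < N%:R.
  exists (Num.bound B); apply: archi_boundP.
  by apply: sumr_ge0 => i _; apply: sumr_ge0.
exists N => i j; set D := (2 ^ N.+1)%N.
have uD : u i j < D%:R.
  apply: (@le_lt_trans _ _ B).
    rewrite /B (bigD1 i) //= (bigD1 j) //= -addrA lerDl addr_ge0 ?sumr_ge0 // => *.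
    by rewrite sumr_ge0.
  apply: lt_trans BN _; rewrite ltr_nat /D.
  by apply: ltn_trans (ltnSn N) _; apply: ltn_expl.
move: uD; rewrite /u ltr_pdivrMr ?subr_gt0 // /c.
set S := \sum_(k : I) `|p i j k|; set T := \sum_(k : I) _ => TD.
have S0 : 0 <= S by rewrite sumr_ge0.
have DD : D.-1%:R <= D%:R :> R by rewrite ler_nat leq_pred.
have := ler_wpM2r S0 DD; nra.
Qed.

(** The rows define the polyhedral norm [max_j |l_j x|], which every Euler step
    [1 + h A_i] contracts; [W] replaces the maximum by a sum of [D]-th powers. *)
Theorem polyhedral_lyapunov_sos : exists W : {mpoly R[n]},
    [/\ homogeneous W,
        sum_of_squares W,
        positive_definite W,
        forall i : 'I_m, sum_of_squares (- lie_derivative (A i) W) &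
        forall i : 'I_m, positive_definite (- lie_derivative (A i) W)].
Proof.
have [r c_gt0] := exponent_exists; set D := (2 ^ r.+1)%N in c_gt0.
have D0 : (0 < D)%N by rewrite expn_gt0.
have evD : ~~ odd D by rewrite oddX.
have sosY j : sum_of_squares (Y j ^+ D).
  by rewrite /D expnSr exprM; exact: sos_sqr.
have sos_gaps i : sum_of_squares (\sum_(j : I) \sum_(k : I)
             `|p i j k| *: amgm_gap D (Y j) (Num.sg (p i j k) *: Y k)).
  by apply: sos_sum => j; apply: sos_sum => k; apply: sosZ => //; exact: sos_amgm_gap.
have pd (a : I -> R) : (forall j, 0 < a j) ->
    positive_definite (\sum_(j : I) a j *: Y j ^+ D).
  move=> a_gt0 x x0.
  have [j yj] : exists j, l j *m x != 0.
    apply/existsP; apply: contraNT x0; rewrite negb_exists => /forallP lx0.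
    by apply/eqP/l_span => j; apply/eqP; have := lx0 j; rewrite negbK.
  rewrite raddf_sum (bigD1 j) //=; apply: ltr_pwDl; last first.
    apply: sumr_ge0 => k _; apply: sos_eval_ge0; apply: sosZ => //.
    exact: ltW.
  rewrite mevalZ mulr_gt0 // rmorphXn /= linear_form_eval exprn_even_gt0 //.
  apply/orP; right; apply: contra yj => /eqP yj; apply/eqP/matrixP => s t.
  by rewrite !ord1 yj mxE.
exists (W D); split.
- exists D; apply: rpred_sum => j _; have := dhomogMn D (linear_form_homog (l j)).
  by rewrite mul1n.
- exact: sos_sum.
- have := pd (fun=> 1); rewrite /W; under eq_bigr do rewrite scale1r.
  by apply.
- move=> i; rewrite decrease //; apply: sosZ; first by rewrite invr_ge0 ltW.
  apply: sosD => //; apply: sos_sum => j; apply: sosZ => //.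
  exact/ltW/c_gt0.
- move=> i x x0; rewrite decrease // mevalZ mulr_gt0 ?invr_gt0 // mevalD.
  apply: ltr_wpDl; last by apply: pd => // j; exact: c_gt0.
  exact: sos_eval_ge0.
Qed.

End Polyhedral.

Section Homogeneity.
Variables (n : nat) (R : realFieldType).
Implicit Types p : {mpoly R[n]}.

(** A name for homogeneity of a given degree that does not depend on the
    polynomial notations, for use in the analytic part. *)
Definition form_of_degree d p : Prop := p \is d.-homog.

Lemma dhomog_mevalZ d p (a : R) (x : 'cV[R]_n) : p \is d.-homog ->
  p.@[fun k => (a *: x) k 0] = a ^+ d * p.@[fun k => x k 0].
Proof.
move=> /dhomogP hp; rewrite !mevalE mulr_sumr.
rewrite big_seq [RHS]big_seq; apply: eq_bigr => mm /hp <-.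
rewrite mulrCA; congr (_ * _); rewrite /= mdegE -prodrXr -big_split /=.
by apply: eq_bigr => k _; rewrite mxE exprMn.
Qed.

Lemma lie_derivative_homog d p (A : 'M[R]_n) :
  p \is d.-homog -> lie_derivative A p \is d.-homog.
Proof.
move=> /dhomogP hp; rewrite (mpolyE p) linear_sum big_seq /=.
apply: rpred_sum => mm /hp mmd; rewrite linearZ; apply: rpredZ.
apply: rpred_sum => k _; rewrite mderivX -scalerAl.
have [->|mk] := eqVneq (mm k) 0%N; first by rewrite scale0r rpred0.
apply: rpredZ; have -> : d = (d.-1 + 1)%N.
  rewrite addn1 prednK // -mmd /= mdegE (bigD1 k) //=.
  by rewrite addn_gt0 lt0n mk.
apply: dhomogM; last first.
  have -> : \sum_(l < n) A k l *: 'X_l = linear_form (row k A).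
    by apply: eq_bigr => l _; rewrite mxE.
  exact: linear_form_homog.
rewrite dhomogX /= -mmd /=.
have /submK <- : (U_(k) <= mm)%MM by rewrite lep1mP.
by rewrite addmK mdegD mdeg1 addn1.
Qed.

Lemma lie_derivative_homog0 p (A : 'M[R]_n) :
  p \is 0.-homog -> lie_derivative A p = 0.
Proof.
move=> hp; rewrite /lie_derivative big1 // => k _.
have -> : p^`M(k) = 0; last by rewrite mul0r.
apply/mpolyP => mm; rewrite mcoeff_mderiv mcoeff0.
by rewrite (dhomog_nemf_coeff hp) ?mul0rn //= mdegD mdeg1 addn1.
Qed.

End Homogeneity.
End Forms.

From mathcomp Require Import all_classical all_reals all_analysis.
From mathcomp Require Import measurable_realfun.
Import Order.TTheory GRing.Theory Num.Theory numFieldNormedType.Exports.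
Local Open Scope classical_set_scope.
Local Open Scope ring_scope.

(** * The maximum norm of matrices *)

Section MatrixNorm.
Variable R : realType.

Lemma mx_norm_leP m n (x : 'M[R]_(m, n)) e : 0 <= e ->
  (forall i j, `|x i j| <= e) <-> `|x| <= e.
Proof.
move=> e0; rewrite [X in _ <-> (X <= _)]/Num.Def.normr /= mx_normrE; split=> [xe|/bigmax_leP[_ xe] i j].
  by apply/bigmax_leP; split.
exact: (xe (i, j)).
Qed.

Lemma ler_entry_mx_norm m n (x : 'M[R]_(m, n)) i j : `|x i j| <= `|x|.
Proof. by move: i j; apply/(mx_norm_leP x (normr_ge0 x)). Qed.

Lemma mx_norm_mulmx m n p (M : 'M[R]_(m, n)) (x : 'M[R]_(n, p)) :
  `|M *m x| <= n%:R * `|M| * `|x|.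
Proof.
apply/mx_norm_leP => [|i j]; first by rewrite !mulr_ge0.
rewrite mxE (le_trans (ler_norm_sum _ _ _)) //.
rewrite -[X in X%:R](card_ord n) -mulrA mulr_natl -sumr_const ler_sum // => k _.
by rewrite normrM ler_pM // ler_entry_mx_norm.
Qed.

End MatrixNorm.

(** * Uniform contraction of long products *)

Section UniformContraction.
Variables (R : realType) (n : nat).
Implicit Types (v w : 'cV[R]_n) (M : 'M[R]_n) (s : seq 'M[R]_n).

(** The first matrix of the sequence acts first, as in a trajectory. *)
Definition transport s v : 'cV[R]_n := foldl (fun w M => M *m w) v s.

Lemma transport_cat s t v : transport (s ++ t) v = transport t (transport s v).
Proof. exact: foldl_cat. Qed.

Lemma transport_is_linear s : linear (transport s).
Proof.
move=> a u v; elim: s u v => //= M s IH u v.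
by rewrite /transport /= mulmxDr -scalemxAr; exact: IH.
Qed.

HB.instance Definition _ s :=
  GRing.isLinear.Build R 'cV[R]_n 'cV[R]_n _ (transport s)
    (transport_is_linear s).

Variables (G : set 'M[R]_n) (C : R).
Hypothesis bounded_products :
  forall s v, all (mem G) s -> `|transport s v| <= C * `|v|.

(** Implied by [L > d] and implying [L >= d], where [L] is the limit superior,
    over the length of the products [P], of the supremum of [|P v|]. *)
Definition recurrent_above (d : R) v := forall K, exists s,
  [/\ (K <= size s)%N, all (mem G) s & d <= `|transport s v|].

Let C_ge0 : (0 < n)%N -> 0 <= C.
Proof.
move=> n0; have := @bounded_products [::] (const_mx 1) isT.
rewrite /transport /=; set N := `|_| => NC.
have N0 : 0 < N.
  by apply: lt_le_trans (ler_entry_mx_norm _ (Ordinal n0) 0); rewrite mxE normr1.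
by rewrite -(pmulr_lge0 _ N0); apply: le_trans NC; exact: ltW.
Qed.

(** Dynamic programming without attained maxima.  If no [M v] were recurrent
    above [d - e], each would have a length beyond which products stay below
    [d - e]; the points [M v] lie in a bounded set, so finitely many of them
    approximate all the others, and one length would serve for all [M]. *)
Lemma recurrent_above_step d e v : (0 < n)%N -> 0 < e -> recurrent_above d v ->
  exists2 M, M \in G & recurrent_above (d - e) (M *m v).
Proof.
move=> n0 e0 bad; apply: contrapT => noM.
have C0 := C_ge0 n0.
pose B := C * `|v|; pose eta := e / (C + 1).
have eta0 : 0 < eta by rewrite divr_gt0 // ltr_wpDl.
have B0 : 0 <= B by rewrite mulr_ge0.
have MvB M i : M \in G -> 0 <= (M *m v) i 0 + B <= B + B.
  move=> GM; have : `|(M *m v) i 0| <= B.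
    apply: le_trans (ler_entry_mx_norm _ _ _) _.
    by have := @bounded_products [:: M] v; rewrite /= GM; apply.
  by rewrite ler_norml => /andP[? ?]; rewrite lerD2r -lerBlDr sub0r; apply/andP.
(* A grid of mesh [eta]: vectors in the same cell differ by at most [eta]. *)
pose Nc := Num.truncn ((B + B) / eta).
pose coord M i := Num.truncn (((M *m v) i 0 + B) / eta).
pose cell M : {ffun 'I_n -> 'I_Nc.+1} := [ffun i => inord (coord M i)].
have cellP M M' : M \in G -> M' \in G -> cell M = cell M' ->
    `|M *m v - M' *m v| <= eta.
  move=> GM GM' cMM'; apply/mx_norm_leP => [|i j]; first exact: ltW.
  have : coord M i = coord M' i.
    move/ffunP/(_ i): cMM'; rewrite !ffunE => /(congr1 val).
    have cN M'' : M'' \in G -> (coord M'' i < Nc.+1)%N.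
      move=> /(MvB _ i) /andP[_ MB]; rewrite ltnS; apply: le_truncn.
      by rewrite ler_pM2r // invr_gt0.
    by rewrite /= !inordK ?cN.
  rewrite /coord (ord1 j) => cE.
  have rng M'' : M'' \in G -> 0 <= ((M'' *m v) i 0 + B) / eta.
    by move=> /(MvB _ i) /andP[? _]; rewrite divr_ge0 // ltW.
  have := truncn_itv (rng _ GM); have := truncn_itv (rng _ GM'); rewrite cE.
  move: (Num.truncn _) => N /andP[a1 a2] /andP[a3 a4].
  rewrite ler_pdivlMr // in a1; rewrite ler_pdivlMr // in a3.
  rewrite ltr_pdivrMr // -natr1 mulrDl mul1r in a2.
  rewrite ltr_pdivrMr // -natr1 mulrDl mul1r in a4.
  rewrite !mxE in a1 a2 a3 a4 *.
  rewrite ler_norml; apply/andP; split; lra.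
have stable (c : {ffun 'I_n -> 'I_Nc.+1}) : exists K, forall M, M \in G -> cell M = c ->
    forall s, (K <= size s)%N -> all (mem G) s -> `|transport s (M *m v)| < d.
  have [[M0 GM0 cM0]|noc] := pselect (exists2 M0, M0 \in G & cell M0 = c); last first.
    by exists 0%N => M GM cM; case: noc; exists M.
  have [K KP] : exists K, forall s, (K <= size s)%N -> all (mem G) s ->
      `|transport s (M0 *m v)| < d - e.
    apply: contrapT => noK; apply: noM; exists M0 => // K.
    apply: contrapT => nos; apply: noK; exists K => s Ks Gs.
    by rewrite ltNge; apply/negP => ds; apply: nos; exists s.
  exists K => M GM cM s Ks Gs.
  rewrite -(subrK (M0 *m v) (M *m v)) raddfD /=.
  apply: le_lt_trans (ler_normD _ _) _.
  have h1 := KP s Ks Gs.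
  have h2 : `|transport s (M *m v - M0 *m v)| <= e.
    apply: le_trans (bounded_products _ Gs) _.
    apply: (@le_trans _ _ (C * eta)); first by rewrite ler_wpM2l // cellP // cM.
    by rewrite /eta mulrA ler_pdivrMr ?ltr_wpDl // mulrC ler_pM2l // lerDl.
  lra.
have [K KP] := choice stable.
have [[|M s] [//= Ks /andP[GM Gs] ds]] := bad (\max_c K c).+1.
have cK : (K (cell M) <= size s)%N.
  by rewrite ltnS in Ks; apply: leq_trans Ks; exact: leq_bigmax.
by have := KP (cell M) M GM erefl s cK Gs; rewrite ltNge ds.
Qed.

Hypothesis infinite_products_vanish : forall (Phi : nat -> 'M[R]_n) v,
  (forall j, Phi j \in G) ->
  forall e, 0 < e -> exists k, `|transport (mkseq Phi k) v| < e.

Lemma transport_mkseqS (Phi : nat -> 'M[R]_n) k v :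
  transport (mkseq Phi k.+1) v = Phi k *m transport (mkseq Phi k) v.
Proof. by rewrite /mkseq -(addn1 k) iotaD map_cat transport_cat. Qed.

(** A recurrent vector would allow an infinite product that stays recurrent: at
    step [j] give up [d / 2^(j+2)], so that at least [d / 2] always remains. *)
Lemma not_recurrent_above d v : (0 < n)%N -> 0 < d -> ~ recurrent_above d v.
Proof.
move=> n0 d0 bad.
pose lev j : R := d / 2 + d / 2 ^+ j.+1.
have levS j : lev j - d / 2 ^+ j.+2 = lev j.+1.
  have : (2 : R) ^+ j.+1 != 0 by rewrite expf_neq0.
  by rewrite /lev (exprS 2 j.+1); move: (2 ^+ j.+1) => X X0; field.
have /choice[f fP] : forall p : nat * 'cV[R]_n, exists M, recurrent_above (lev p.1) p.2 ->
    M \in G /\ recurrent_above (lev p.1.+1) (M *m p.2).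
  case=> j w /=.
  have [bw|nbw] := pselect (recurrent_above (lev j) w); last by exists 0.
  have e0 : 0 < d / 2 ^+ j.+2 by rewrite divr_gt0 // exprn_gt0.
  have [M GM bM] := recurrent_above_step n0 e0 bw.
  by exists M => _; rewrite -levS.
pose fix x j := if j is k.+1 then f (k, x k) *m x k else v.
have xbad j : recurrent_above (lev j) (x j).
  elim: j => [|j IH]; last by have [] := fP (j, x j) IH.
  by rewrite /lev expr1 -splitr.
pose Phi j := f (j, x j).
have xE j : x j = transport (mkseq Phi j) v.
  by elim: j => // j IH; rewrite transport_mkseqS -IH.
have C0 := C_ge0 n0.
have [||k] := @infinite_products_vanish Phi v _ (d / 2 / (C + 1)).
- by move=> j; have [] := fP (j, x j) (xbad j).
- by rewrite !divr_gt0 // ltr_wpDl.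
rewrite -xE ltr_pdivlMr ?ltr_wpDl // => xk.
have [s [_ Gs ds]] := xbad k 0%N.
have := bounded_products (x k) Gs.
have : d / 2 < lev k by rewrite /lev ltrDl divr_gt0 // exprn_gt0.
have := normr_ge0 (x k); nra.
Qed.

(** It suffices to control the images of the finitely many basis vectors. *)
Theorem uniform_contraction rho : 0 < rho -> exists K, forall s v,
  (K <= size s)%N -> all (mem G) s -> `|transport s v| <= rho * `|v|.
Proof.
move=> rho0; have [n0|n0] := posnP n.
  exists 0%N => s v _ _.
  have z w : `|w| = 0.
    by apply/eqP; rewrite normr_eq0; apply/eqP/matrixP => -[i lti]; exfalso; rewrite n0 in lti.
  by rewrite !z mulr0.
pose d := rho / n%:R.
have d0 : 0 < d by rewrite divr_gt0 // ltr0n.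
have /choice[K KP] : forall i : 'I_n, exists k, forall s, (k <= size s)%N ->
    all (mem G) s -> `|transport s (delta_mx i 0)| < d.
  move=> i.
  apply: contrapT => noK; apply: (@not_recurrent_above d (delta_mx i 0)) => // k.
  apply: contrapT => nos; apply: noK; exists k => s ks Gs.
  by rewrite ltNge; apply/negP => ds; apply: nos; exists s.
exists (\max_i K i)%N => s v Ks Gs.
have vE : v = \sum_i v i 0 *: delta_mx i 0.
  by rewrite {1}[v]matrix_sum_delta; apply: eq_bigr => i _; rewrite big_ord1.
rewrite {1}vE linear_sum /=.
apply: le_trans (ler_norm_sum _ _ _) _.
have -> : rho * `|v| = \sum_(i < n) d * `|v|.
  by rewrite sumr_const card_ord -mulr_natl mulrA /d mulrCA mulfV ?mulr1 ?pnatr_eq0 ?lt0n_neq0.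
apply: ler_sum => i _; rewrite linearZ /= normrZ mulrC ler_pM //.
  by apply/ltW/KP => //; apply: leq_trans Ks; exact: leq_bigmax.
exact: ler_entry_mx_norm.
Qed.

End UniformContraction.

(** * The matrix exponential *)

Section EntrywiseDerivative.
Variables (R : realType) (m n : nat) (M : R -> 'M[R]_(m, n)) (t : R).

Lemma is_derive_mx (D : 'M[R]_(m, n)) :
  (forall i j, is_derive t 1 (fun s => M s i j) (D i j)) -> is_derive t 1 M D.
Proof.
move=> MD; have dM : derivable M t 1.
  by apply/derivable_mxP => i j; have [] := MD i j.
apply: DeriveDef => //; rewrite derive_mx //; apply/matrixP => i j.
by rewrite mxE; have [] := MD i j.
Qed.

Lemma is_derive_entry (D : 'M[R]_(m, n)) i j :
  is_derive t 1 M D -> is_derive t 1 (fun s => M s i j) (D i j).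
Proof.
move=> [dM <-]; rewrite derive_mx // mxE; apply: DeriveDef => //.
by move/derivable_mxP : dM; exact.
Qed.

End EntrywiseDerivative.

Section MatrixExponential.
Variables (R : realType) (n : nat) (A : 'M[R]_n).

Definition mxpow k : 'M[R]_n := iter k (mulmx A) 1%:M.

Let coef a b k : R := mxpow k a b / k`!%:R.

(** Defined entrywise, so that the differentiation theorem for real power
    series applies. *)
Definition expm (t : R) : 'M[R]_n := \matrix_(a, b) limn (pseries (coef a b) t).

(** This bound passes to formal derivatives and makes a power series converge
    everywhere. *)
Let dominated (B : R) (c : nat -> R) := forall k,
  `|c k| <= B * ((n%:R * `|A|) ^+ k / k`!%:R).

Let dominated_cvg B c t : dominated B c -> cvgn (pseries c t).
Proof.
move=> cB; apply: normed_cvg; rewrite /normed_series_of /=.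
have B0 : 0 <= B.
  by have := le_trans (normr_ge0 _) (cB 0%N); rewrite expr0 fact0 divr1 mulr1.
have := is_cvg_seriesZ (k := B) (is_cvg_series_exp_coeff (n%:R * `|A| * `|t|)).
have le k : `|c k * t ^+ k| <= (B *: exp_coeff (n%:R * `|A| * `|t|)) k.
  rewrite normrM normrX.
  rewrite -[leRHS]/(B * ((n%:R * `|A| * `|t|) ^+ k / k`!%:R)) exprMn.
  have := ler_wpM2r (exprn_ge0 k (normr_ge0 t)) (cB k).
  by move=> /le_trans; apply; rewrite -!mulrA [_^-1 * _]mulrC.
apply: series_le_cvg => // k; apply: le_trans (le k); exact: normr_ge0.
Qed.

Let dominated_diffs B c : dominated B c ->
  dominated (B * (n%:R * `|A|)) (pseries_diffs c).
Proof.
move=> cB k; rewrite /pseries_diffs normrM normr_nat.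
apply: le_trans (ler_wpM2l (ler0n _ _) (cB k.+1)) _.
rewrite factS natrM invfM exprS le_eqVlt; apply/orP; left; apply/eqP.
have : k.+1%:R != 0 :> R by rewrite pnatr_eq0.
have : k`!%:R != 0 :> R by rewrite pnatr_eq0 -lt0n fact_gt0.
move: (_ ^+ k) (k.+1%:R) (k`!%:R) => x y z z0 y0; field.
by rewrite z0 y0.
Qed.

Let dominated_coef a b : dominated 1 (coef a b).
Proof.
move=> k; rewrite mul1r normrM normfV normr_nat ler_pM2r ?invr_gt0 ?ltr0n ?fact_gt0 //.
apply: le_trans (ler_entry_mx_norm _ _ _) _.
elim: k => [|k IH] /=.
  apply/mx_norm_leP => // i j; rewrite mxE expr0.
  by case: (i == j); rewrite ?normr1 // normr0.
apply: le_trans (mx_norm_mulmx _ _) _.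
by rewrite exprS ler_wpM2l // mulr_ge0.
Qed.

Let diffs_coef a b :
  pseries_diffs (coef a b) = (fun k => \sum_d A a d * coef d b k).
Proof.
apply/funext => k; rewrite /pseries_diffs /coef /= mxE factS natrM invfM.
rewrite mulrCA mulVKf ?pnatr_eq0 // mulr_suml.
by apply: eq_bigr => d _; rewrite mulrA.
Qed.

Lemma expm0 : expm 0 = 1%:M.
Proof.
apply/matrixP => a b; rewrite mxE.
have -> : 1%:M a b = coef a b 0 by rewrite /coef fact0 divr1.
apply: lim_near_cst => //; near=> N.
rewrite /pseries /series /= -[N]prednK; last by near: N; exists 1%N.
rewrite big_nat_recl //= expr0 mulr1 big1_seq ?addr0 // => i _.
by rewrite expr0n mulr0.
Unshelve. all: by end_near. Qed.

Lemma is_derive_expm (t : R) : is_derive t (1 : R) expm (A *m expm t).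
Proof.
apply: is_derive_mx => a b.
have c1 c B K : dominated B c -> cvgn (pseries c K) by exact: dominated_cvg.
have -> : (fun s => expm s a b) = (fun s => limn (pseries (coef a b) s)).
  by apply/funext => s; rewrite mxE.
have -> : (A *m expm t) a b = limn (pseries (pseries_diffs (coef a b)) t).
  apply/esym/cvg_lim => //; rewrite mxE diffs_coef.
  have -> : pseries (fun k => \sum_d A a d * coef d b k) t =
      (fun N => \sum_d A a d * pseries (coef d b) t N).
    apply/funext => N; rewrite /pseries /series /=.
    under eq_bigr do rewrite mulr_suml.
    rewrite exchange_big; apply: eq_bigr => d _; rewrite mulr_sumr.
    by apply: eq_bigr => k _; rewrite mulrA.
  apply: cvg_big => [|d _]; first exact: (@add_continuous R).
  by rewrite mxE; apply: cvgM; [exact: cvg_cst | exact: (c1 _ _ _ (dominated_coef d b))].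
have dc := dominated_coef a b.
apply: (@pseries_snd_diffs _ _ (`|t| + 1)).
- exact: c1 dc.
- exact: c1 (dominated_diffs dc).
- exact: c1 (dominated_diffs (dominated_diffs dc)).
- by rewrite [ltRHS]ger0_norm ?addr_ge0 // ltrDl.
Qed.

End MatrixExponential.

Section MeanValue.
Variables (R : realType) (m n : nat).

Lemma mx_mean_value (M D : R -> 'M[R]_(m, n)) (a b K : R) : a <= b -> 0 <= K ->
  (forall t : R, t \in `[a, b] -> is_derive t (1 : R) M (D t)) ->
  (forall t, t \in `[a, b] -> `|D t| <= K) ->
  `|M b - M a| <= K * (b - a).
Proof.
move=> ab K0 MD DK; apply/mx_norm_leP => [|i j].
  by rewrite mulr_ge0 // subr_ge0.
have dM t : t \in `[a, b] -> is_derive t (1 : R) (fun s => M s i j) (D t i j).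
  by move=> tab; apply: is_derive_entry; exact: MD.
rewrite !mxE.
have cM : {within `[a, b], continuous (fun s => M s i j)}.
  by apply: derivable_within_continuous => t tab; have [] := dM t tab.
have dM' t : t \in `]a, b[ -> is_derive t (1 : R) (fun s => M s i j) (D t i j).
  by rewrite in_itv => /andP[t1 t2]; apply: dM; rewrite in_itv /= !ltW.
have [c cab MbMa] := MVT_segment ab dM' cM.
rewrite MbMa normrM (ger0_norm (_ : 0 <= b - a)) ?subr_ge0 // ler_wpM2r ?subr_ge0 //.
exact: le_trans (ler_entry_mx_norm _ _ _) (DK _ cab).
Qed.

End MeanValue.

Section ExponentialEstimates.
Variables (R : realType) (n : nat) (A : 'M[R]_n).

Lemma expm_bounded : exists2 B, 0 <= B &
  forall t : R, t \in `[0, 1] -> `|expm A t| <= B.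
Proof.
have cont : {within `[0, 1], continuous (fun t : R => `|expm A t|)}.
  apply: continuous_subspaceT => t; apply: (@continuous_comp _ _ _ (expm A)).
    have [dE _] := is_derive_expm A t.
    exact/differentiable_continuous/derivable1_diffP.
  exact: norm_continuous.
have [c c01 cmax] := EVT_max ler01 cont.
by exists `|expm A c|.
Qed.

(** The derivative of [exp (t A) - t A] is [A (exp (t A) - 1)], which is itself
    [O(t)]; the mean value inequality is used twice. *)
Lemma expm_second_order : exists2 c, 0 <= c &
  forall t : R, t \in `[0, 1] -> `|expm A t - (1%:M + t *: A)| <= c * t ^+ 2.
Proof.
have [B B0 EB] := expm_bounded.
pose K := n%:R * `|A| * B.
have K0 : 0 <= K by rewrite !mulr_ge0.
exists (n%:R * `|A| * K) => [|t]; first by rewrite !mulr_ge0.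
rewrite in_itv /= => /andP[t0 t1].
have E1 s : 0 <= s <= t -> `|expm A s - 1%:M| <= K * s.
  move=> /andP[s0 st]; rewrite -(expm0 A) -[X in K * X]subr0.
  apply: (mx_mean_value s0 K0) => [r _|r]; first exact: is_derive_expm.
  rewrite in_itv /= => /andP[r0 rs]; apply: le_trans (mx_norm_mulmx _ _) _.
  rewrite ler_wpM2l ?mulr_ge0 // EB // in_itv /= r0 /=.
  by rewrite (le_trans rs) // (le_trans st).
clearbody K.
have dM s : is_derive s (1 : R) (fun r => expm A r - r *: A) (A *m expm A s - A).
  apply: is_derive_mx => i j.
  have d1 := is_derive_entry i j (is_derive_expm A s).
  have subE (X Y : 'M[R]_n) : (X - Y) i j = X i j - Y i j by rewrite !mxE.
  have -> : (fun r => (expm A r - r *: A) i j) =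
     (fun r => expm A r i j) - (A i j \*: id).
    by apply/funext => r; rewrite subE [in X in _ - X]mxE [r * _]mulrC.
  have dA : is_derive s (1 : R) (A i j \*: id) (A i j).
    by rewrite -[X in is_derive _ _ _ X]mulr1; apply: is_deriveZ.
  by rewrite subE; apply: is_deriveB.
have -> : expm A t - (1%:M + t *: A) =
    (expm A t - t *: A) - (expm A 0 - 0 *: A).
  by rewrite expm0 scale0r subr0 opprD [- _ + _]addrC addrA.
have := @mx_mean_value _ _ _ (fun r => expm A r - r *: A) _ 0 t
  (n%:R * `|A| * (K * t)) t0 _ (fun s _ => dM s) _.
rewrite subr0 expr2 !mulrA; apply; first by rewrite !mulr_ge0.
move=> s; rewrite in_itv /= => st; rewrite -[X in _ - X]mulmx1 -mulmxBr.
apply: le_trans (mx_norm_mulmx _ _) _; rewrite -!mulrA ler_wpM2l // ler_wpM2l //.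
apply: le_trans (E1 _ st) _; rewrite ler_wpM2l //.
by case/andP: st.
Qed.

End ExponentialEstimates.

(** * Piecewise smooth solutions *)

Section Auxiliary.
Variable R : realType.

Lemma countableU T (D E : set T) : countable D -> countable E -> countable (D `|` E).
Proof.
move=> cD cE; rewrite -bigcup2E; apply: bigcup_countable => // i _.
by case: i => [|[|i]] /=.
Qed.

Lemma gt_nbhsr (a x : R) : a < x -> \forall y \near x, a < y.
Proof.
move=> ax; exists (x - a) => /=; first by rewrite subr_gt0.
by move=> y /= /(le_lt_trans (ler_norm _)); rewrite ltrD2l ltrN2.
Qed.

End Auxiliary.

Section DerivativeShift.
Variables (R : realType) (V : normedModType R).

Lemma is_derive_shift (y : R -> V) (S t : R) (D : V) :
  is_derive (t - S) (1 : R) y D -> is_derive t (1 : R) (fun s => y (s - S)) D.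
Proof.
have E : (fun h : R => h^-1 *: (((fun s => y (s - S)) \o shift t) (h *: (1 : R)) - y (t - S)))
       = (fun h : R => h^-1 *: ((y \o shift (t - S)) (h *: (1 : R)) - y (t - S))).
  by apply/funext => h /=; rewrite addrA.
move=> [dy yD]; apply: DeriveDef; first by move: dy; rewrite /derivable -E.
by rewrite -yD /derive -E.
Qed.

End DerivativeShift.

Section Trajectories.
Variables (R : realType) (n m : nat) (A : 'I_m -> 'M[R]_n).
Implicit Types (x y : R -> 'cV[R]_n).

Definition admissible_at x (t : R) : Prop :=
  exists2 B, matrix_convex_hull A B & is_derive t (1 : R) x (B *m x t).

(** A solution on [[0, T]] whose exceptional times form a countable set: unlike
    negligible sets, countable ones are trivially stable under the time shift
    that concatenation requires. *)
Definition trajectory (T : R) x : Prop :=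
  (exists2 L, 0 <= L & forall s t, 0 <= s -> s <= t -> t <= T ->
     `|x t - x s| <= L * (t - s)) /\
  (exists2 D : set R, countable D & forall t, 0 < t -> t < T -> ~ D t ->
     admissible_at x t).

Lemma admissible_at_near x y t :
  (\near t, x t = y t) -> admissible_at x t -> admissible_at y t.
Proof.
move=> xy [B AB xB]; exists B => //; rewrite -(nbhs_singleton xy).
exact: near_eq_is_derive xy xB.
Qed.

Lemma trajectory_congr T x y :
  (forall t, 0 <= t -> t <= T -> x t = y t) -> trajectory T x -> trajectory T y.
Proof.
move=> xy [[L L0 xL] [D cD xD]]; split.
  exists L => // s t s0 st tT; rewrite -!xy ?xL ?(le_trans s0) //.
  exact: le_trans st tT.
exists D => // t t0 tT Dt; apply: admissible_at_near (xD t t0 tT Dt).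
near=> s; apply: xy; first by apply: ltW; near: s; exact: gt_nbhsr.
by apply: ltW; near: s; exact: lt_nbhsl.
Unshelve. all: by end_near. Qed.

Lemma trajectory_glue S T x y : 0 <= S -> 0 <= T ->
  trajectory S x -> trajectory T y -> x S = y 0 ->
  trajectory (S + T) (fun t => if t <= S then x t else y (t - S)).
Proof.
move=> S0 T0 [[L L0 xL] [D cD xD]] [[K K0 yK] [E cE yE]] xy.
split; last first.
  exists (D `|` [set S] `|` (+%R S @` E)).
    apply: countableU; first by apply: countableU => //; exact: countable1.
    exact: sub_countable (card_image_le _ _) cE.
  move=> t t0 tST /not_orP[/not_orP[Dt St] Et].
  case: (ltgtP t S) => [tS|St'|//].
    apply: admissible_at_near (xD t t0 tS Dt).
    near=> s; case: ifPn => // /negP[]; apply: ltW; near: s; exact: lt_nbhsl.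
  have [B AB yB] : admissible_at y (t - S).
    apply: yE; [by rewrite subr_gt0 | by rewrite ltrBlDl |].
    by move=> Ets; apply: Et; exists (t - S) => //; rewrite subrKC.
  apply: (@admissible_at_near (fun s => y (s - S))).
    near=> s; case: ifPn => //; rewrite leNgt => /negP[]; near: s.
    exact: gt_nbhsr.
  by exists B => //; exact: is_derive_shift.
exists (L + K) => [|s t s0 st tST]; first exact: addr_ge0.
have [tS|St] := leP t S.
  rewrite (le_trans st tS); apply: le_trans (xL _ _ s0 st tS) _.
  by rewrite ler_wpM2r ?subr_ge0 // lerDl.
have yT : t - S <= T by rewrite lerBlDl.
have [sS|Ss] := leP s S; last first.
  have := yK (s - S) (t - S); rewrite subr_ge0 (ltW Ss) lerB // => /(_ isT isT yT).
  rewrite opprB subrKA => /le_trans; apply.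
  by rewrite ler_wpM2r ?subr_ge0 // lerDr.
have := yK 0 (t - S) (lexx 0); rewrite subr_ge0 (ltW St) => /(_ isT yT) h1.
have h2 := xL s S s0 sS (lexx _).
rewrite -(subrKA (x S)) {1}xy; apply: le_trans (ler_normD _ _) _.
apply: le_trans (lerD h1 h2) _; nra.
Unshelve. all: by end_near. Qed.

Lemma is_derive_mulmxr (M D : R -> 'M[R]_n) (t : R) (v : 'cV[R]_n) :
  is_derive t (1 : R) M (D t) ->
  is_derive t (1 : R) (fun s => M s *m v) (D t *m v).
Proof.
move=> MD; apply: is_derive_mx => i j.
have -> : (fun s => (M s *m v) i j) =
    \sum_k (v k j \*: (fun s => M s i k)).
  apply/funext => s; rewrite mxE fct_sumE.
  by apply: eq_bigr => k _; rewrite mulrC.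
have -> : (D t *m v) i j = \sum_k v k j *: D t i k.
  by rewrite mxE; apply: eq_bigr => k _; rewrite mulrC.
by apply: is_derive_sum => k; apply: is_deriveZ; exact: is_derive_entry.
Qed.

Lemma trajectory_expm i (v : 'cV[R]_n) h : h <= 1 ->
  trajectory h (fun t => expm (A i) t *m v).
Proof.
move=> h1; have [B B0 EB] := expm_bounded (A i).
have dx t : is_derive t (1 : R) (fun t => expm (A i) t *m v)
    (A i *m (expm (A i) t *m v)).
  rewrite mulmxA; apply: (@is_derive_mulmxr _ (fun t => A i *m expm (A i) t)).
  exact: is_derive_expm.
split; last first.
  exists set0; first exact: countable0.
  move=> t _ _ _; exists (A i); last exact: dx.
  exists (fun j => (j == i)%:R); split => //.
    by rewrite (bigD1 i) //= eqxx big1 ?addr0 // => j /negbTE ->.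
  rewrite (bigD1 i) //= eqxx scale1r big1 ?addr0 // => j /negbTE ->.
  by rewrite scale0r.
exists (n%:R * `|A i| * (n%:R * B * `|v|)); first by rewrite !mulr_ge0.
move=> s t s0 st th.
apply: (@mx_mean_value _ _ _ _ (fun t => A i *m (expm (A i) t *m v))) => //.
  by rewrite !mulr_ge0.
move=> r; rewrite in_itv /= => /andP[sr rt].
apply: le_trans (mx_norm_mulmx _ _) _; rewrite ler_wpM2l ?mulr_ge0 //.
apply: le_trans (mx_norm_mulmx _ _) _; rewrite ler_wpM2r // ler_wpM2l // EB //.
by rewrite in_itv /= (le_trans s0) // (le_trans rt) // (le_trans th).
Qed.

(** The trajectory is chosen for each initial vector: a common curve of
    matrices would complicate concatenation for no benefit. *)
Definition reachable (T : R) (M : 'M[R]_n) : Prop := forall v,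
  exists x, [/\ trajectory T x, x 0 = v & x T = M *m v].

Lemma reachable_expm i h : 0 <= h -> h <= 1 -> reachable h (expm (A i) h).
Proof.
move=> h0 h1 v; exists (fun t => expm (A i) t *m v); split => //.
  exact: trajectory_expm.
by rewrite expm0 mul1mx.
Qed.

Lemma reachable0 : reachable 0 1%:M.
Proof.
move=> v; exists (fun=> v); split; rewrite ?mul1mx //; split.
  by exists 0 => // s t _ _ _; rewrite subrr normr0 mul0r.
exists set0; first exact: countable0.
by move=> t t0 /(lt_trans t0); rewrite ltxx.
Qed.

Lemma reachable_mul S T M N : 0 <= S -> 0 <= T ->
  reachable S M -> reachable T N -> reachable (S + T) (N *m M).
Proof.
move=> S0 T0 SM TN v; have [x [xS x0 xM]] := SM v.
have [y [yT y0 yN]] := TN (M *m v).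
exists (fun t => if t <= S then x t else y (t - S)); split.
- by apply: trajectory_glue => //; rewrite xM y0.
- by rewrite S0.
- rewrite addrAC subrr add0r -mulmxA -yN gerDl; case: leP => // Tle0.
  have -> : T = 0 by apply/eqP; rewrite eq_le Tle0 T0.
  by rewrite addr0 xM y0.
Qed.

Lemma trajectories_solution x : (forall k : nat, trajectory k%:R x) ->
  inclusion_solution A x.
Proof.
move=> xk; split.
  move=> T T0 e e0; have [[L L0 xL] _] := xk (Num.bound T).
  have TB : T <= (Num.bound T)%:R by apply/ltW/archi_boundP/ltW.
  exists (e / (L + 1)); first by rewrite divr_gt0 // ltr_wpDl.
  move=> N u v uv _; rewrite ltr_pdivlMr ?ltr_wpDl // => uvd.
  apply: le_lt_trans uvd.
  apply: (@le_trans _ _ (\sum_(k < N) L * (v k - u k))).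
    apply: ler_sum => k _; have [u0 uvk vT] := uv k.
    by apply: xL => //; exact: le_trans vT TB.
  rewrite -mulr_sumr mulrC ler_wpM2l ?lerDl //.
  by apply: sumr_ge0 => k _; have [_ uvk _] := uv k; rewrite subr_ge0.
have /choice[D DP] : forall k : nat, exists D : set R, countable D /\
    forall t, 0 < t -> t < k%:R -> ~ D t -> admissible_at x t.
  by move=> k; have [_ [D cD xD]] := xk k; exists D.
have cD : countable (\bigcup_k D k).
  by apply: bigcup_countable => // k _; have [] := DP k.
have nD : (@lebesgue_measure R).-negligible (\bigcup_k D k).
  apply/negligibleP; first exact: countable_measurable.
  exact: countable_lebesgue_measure0.
apply: negligibleS nD.
move=> t /=; apply: contra_notP => Dt t0.
have [_ xD] := DP (Num.bound t); apply: xD => //.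
  exact/archi_boundP/ltW.
by move=> Dkt; apply: Dt; exists (Num.bound t).
Qed.

(** On [[k, k + 1]] the solution is a translate of a trajectory from the [k]-th
    partial product to the next one. *)
Lemma infinite_trajectory (Phi : nat -> 'M[R]_n) v :
  (forall j, reachable 1 (Phi j)) ->
  exists x, [/\ inclusion_solution A x, x 0 = v &
    forall k : nat, x k%:R = transport (mkseq Phi k) v].
Proof.
move=> rPhi; pose w k := transport (mkseq Phi k) v.
have /choice[y yP] : forall k : nat, exists y,
    [/\ trajectory 1 y, y 0 = w k & y 1 = w k.+1].
  move=> k; have [y [y1 y0 yw]] := rPhi k (w k).
  by exists y; split => //; rewrite yw /w transport_mkseqS.
pose x t := y (Num.truncn t) (t - (Num.truncn t)%:R).
have xk k : x k%:R = w k.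
  by rewrite /x natrK subrr; have [] := yP k.
have xE k t : k%:R <= t -> t <= k%:R + 1 -> x t = y k (t - k%:R).
  move=> kt; rewrite le_eqVlt => /orP[/eqP -> | tk].
    by rewrite natr1 xk -natr1 addrC addKr; have [] := yP k.
  by rewrite /x (@truncn_def _ t k) // kt -natr1.
exists x; split => //; last by rewrite -[0]/(0%:R) xk.
apply: trajectories_solution; elim=> [|k IH].
  have [x0 [x0T x00 _]] := reachable0 (x 0).
  apply: trajectory_congr x0T => t t0 t1.
  by rewrite (_ : t = 0) //; apply/eqP; rewrite eq_le t0 t1.
have [y1 y0 yw] := yP k; rewrite -natr1.
have := trajectory_glue (ler0n _ k) ler01 IH y1.
rewrite xk y0 => /(_ erefl); apply: trajectory_congr => t t0 tk.
by case: leP => // kt; rewrite -xE // ltW.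
Qed.

End Trajectories.

(** * A polyhedral norm contracted by Euler steps *)

Section PolyhedralNorm.
Variables (R : realType) (n m : nat) (A : 'I_m -> 'M[R]_n).
Variables (h delta C : R) (E : 'I_m -> 'M[R]_n) (N : nat).

(** As for [transport], the first letter acts first. *)
Definition word_product (w : seq 'I_m) : 'M[R]_n :=
  foldr (fun i M => M *m E i) 1%:M w.

Hypotheses (h_gt0 : 0 < h) (N_gt0 : (0 < N)%N)
  (E_euler : forall i, `|E i - (1%:M + h *: A i)| <= delta)
  (short_words : forall w, (size w < N)%N -> `|word_product w| <= C)
  (long_words : forall w a, size w = N ->
     \sum_b `|word_product w a b| <= 4^-1)
  (small_delta : n%:R * (2 * (n%:R * C * delta)) < (2 * N%:R)^-1).

(** Between 1 and 2 on short words, and increasing in such a way that the ratio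
    of consecutive weights is at most [1 - 1 / (2 N)]. *)
Let weight (j : nat) : R := 1 + j%:R / N%:R.
Let I : finType := (N.-1.-bseq 'I_m * 'I_n)%type.
Let face (k : I) : 'rV[R]_n := weight (size k.1) *: row k.2 (word_product k.1).

(** Membership in [kappa] times the symmetric convex hull of the faces. *)
Let combination (kappa : R) (u : 'rV[R]_n) : Prop :=
  exists2 p : I -> R, u = \sum_k p k *: face k & \sum_k `|p k| <= kappa.

Let combination_face k : combination 1 (face k).
Proof.
exists (fun j => (j == k)%:R).
  rewrite (bigD1 k) //= eqxx scale1r big1 ?addr0 // => j /negbTE ->.
  by rewrite scale0r.
rewrite (bigD1 k) //= eqxx normr1 big1 ?addr0 // => j /negbTE ->.
by rewrite normr0.
Qed.

Let combinationZ a kappa u : combination kappa u -> combination (`|a| * kappa) (a *: u).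
Proof.
move=> [p -> pk]; exists (fun k => a * p k).
  by rewrite scaler_sumr; apply: eq_bigr => k _; rewrite scalerA.
by under eq_bigr do rewrite normrM; rewrite -mulr_sumr ler_wpM2l.
Qed.

Let combinationD kappa kappa' u u' : combination kappa u -> combination kappa' u' ->
  combination (kappa + kappa') (u + u').
Proof.
move=> [p -> pk] [q -> qk]; exists (fun k => p k + q k).
  by rewrite -big_split; apply: eq_bigr => k _; rewrite scalerDl.
apply: le_trans (lerD pk qk); rewrite -big_split; apply: ler_sum => k _.
exact: ler_normD.
Qed.

Let combinationW kappa kappa' u : kappa <= kappa' ->
  combination kappa u -> combination kappa' u.
Proof. by move=> kk [p -> pk]; exists p => //; exact: le_trans pk kk. Qed.

Let face_nil b : face ([bseq], b) = delta_mx 0 b.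
Proof.
by rewrite /face /= /weight mul0r addr0 scale1r row1.
Qed.

Let combination_row (u : 'rV[R]_n) : combination (\sum_b `|u 0 b|) u.
Proof.
have sumC (s : seq 'I_n) : combination (\sum_(b <- s) `|u 0 b|)
    (\sum_(b <- s) u 0 b *: delta_mx 0 b).
  elim: s => [|b s IH].
    rewrite !big_nil; exists (fun=> 0); first by rewrite big1 // => k _; rewrite scale0r.
    by rewrite big1 // => k _; rewrite normr0.
  rewrite !big_cons; apply: combinationD => //.
  by rewrite -face_nil -[X in combination X]mulr1; exact/combinationZ/combination_face.
by have := sumC (index_enum 'I_n); rewrite -row_sum_delta.
Qed.

Let weight_ge1 j : 1 <= weight j.
Proof. by rewrite /weight lerDl divr_ge0. Qed.

Let weight_le2 j : (j <= N)%N -> weight j <= 2.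
Proof.
move=> jN; rewrite /weight -[2]/(1 + 1) lerD2l ler_pdivrMr ?ltr0n // mul1r.
by rewrite ler_nat.
Qed.

(** If the longer word is still short, the gain comes from the weights;
    otherwise its product is small and the faces of the empty word, which are
    the coordinate forms, express it. *)
Let combination_extend (w : N.-1.-bseq 'I_m) a i :
  combination (1 - (2 * N%:R)^-1)
    (weight (size w) *: row a (word_product (i :: w))).
Proof.
have N0 : 0 < N%:R :> R by rewrite ltr0n.
have wN : (size w < N)%N by apply: leq_ltn_trans (size_bseq w) _; rewrite ltn_predL.
have [wN'|] := ltnP (size w).+1 N.
  have wb : (size (i :: w) <= N.-1)%N by rewrite /= -ltnS prednK.
  have -> : weight (size w) *: row a (word_product (i :: w)) =
      (weight (size w) / weight (size w).+1) *: face (Bseq wb, a).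
    rewrite /face scalerA /= divfK // gt_eqF //.
    exact: lt_le_trans ltr01 (weight_ge1 _).
  apply: combinationW (combinationZ _ (combination_face _)).
  rewrite mulr1 ger0_norm; last first.
    by rewrite divr_ge0 // (le_trans ler01 (weight_ge1 _)).
  have w1 := weight_ge1 (size w).+1; have w2 := weight_le2 wN.
  have w0 : 0 < weight (size w).+1 by exact: lt_le_trans ltr01 w1.
  have -> : weight (size w) = weight (size w).+1 - N%:R^-1.
    rewrite /weight -natr1; field; exact: lt0r_neq0.
  rewrite mulrBl mulfV ?gt_eqF // lerD2l lerN2 -invfM lef_pV2 ?posrE ?mulr_gt0 //.
  by rewrite mulrC ler_wpM2r // ltW.
rewrite leq_eqVlt ltnNge wN orbF => /eqP NE.
apply: combinationW (combinationZ _ (combination_row _)).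
rewrite ger0_norm; last exact: le_trans ler01 (weight_ge1 _).
have -> : \sum_b `|row a (word_product (i :: w)) 0 b| =
    \sum_b `|word_product (i :: w) a b|.
  by apply: eq_bigr => b _; rewrite mxE.
have h1 := long_words a (esym NE : size (i :: w) = N).
have h2 := weight_le2 (ltnW wN); have h3 := weight_ge1 (size w).
have h4 : (2 * N%:R)^-1 <= 2^-1 :> R.
  rewrite lef_pV2 ?posrE ?mulr_gt0 // ler_peMr // ler1n //.
have h5 : 0 <= \sum_b `|word_product (i :: w) a b| by rewrite sumr_ge0.
have : weight (size w) * \sum_b `|word_product (i :: w) a b| <= 2 * 4^-1.
  by apply: ler_pM => //; exact: le_trans ler01 _.
move=> /le_trans; apply; lra.
Qed.

(** Replacing [E i] by the Euler step costs an error that the coordinate forms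
    express, and that is smaller than the gain of [combination_extend]. *)
Let contraction i k : exists p : I -> R,
  face k *m (1%:M + h *: A i) = \sum_j p j *: face j /\ \sum_j `|p j| < 1.
Proof.
case: k => w a; set D := E i - (1%:M + h *: A i).
have wN : (size w < N)%N by apply: leq_ltn_trans (size_bseq w) _; rewrite ltn_predL.
pose r := - (weight (size w) *: row a (word_product w *m D)).
have -> : face (w, a) *m (1%:M + h *: A i) =
    weight (size w) *: row a (word_product (i :: w)) + r.
  rewrite /r /face /= -scalerBr -linearB /= -mulmxBr /D subKr.
  by rewrite -scalemxAl row_mul.
have cr : combination (n%:R * (2 * (n%:R * C * delta))) r.
  apply: combinationW (combination_row _).
  rewrite -[X in X%:R](card_ord n) mulr_natl -sumr_const; apply: ler_sum => b _.
  rewrite /r mxE normrN mxE normrM ger0_norm; last exact: le_trans ler01 (weight_ge1 _).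
  rewrite mxE; apply: ler_pM => //; first exact: le_trans ler01 (weight_ge1 _).
    exact/weight_le2/ltnW.
  apply: le_trans (ler_entry_mx_norm _ _ _) _.
  apply: le_trans (mx_norm_mulmx _ _) _.
  by rewrite card_ord; apply: ler_pM; rewrite ?mulr_ge0 // ?E_euler // ler_wpM2l // short_words.
have [p pE pk] := combinationD (combination_extend w a i) cr.
exists p; split => //; apply: le_lt_trans pk _.
by rewrite -ltrBrDl opprB addrC subrK.
Qed.

Lemma polyhedral_contraction_lyapunov : exists W : mpoly.mpoly n R,
    [/\ homogeneous W,
        sum_of_squares W,
        positive_definite W,
        forall i : 'I_m, sum_of_squares (- lie_derivative (A i) W) &
        forall i : 'I_m, positive_definite (- lie_derivative (A i) W)].
Proof.
have /choice[p pP] : forall ik : 'I_m * I, exists p : I -> R,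
  face ik.2 *m (1%:M + h *: A ik.1) = \sum_j p j *: face j /\ \sum_j `|p j| < 1.
  by case=> i k; exact: contraction.
apply: (@Forms.polyhedral_lyapunov_sos n m R A I face h (fun i k => p (i, k))) => //.
- by move=> i k; have [] := pP (i, k).
- by move=> i k; have [] := pP (i, k).
- move=> x fx; apply/matrixP => b j; rewrite ord1 mxE.
  by have := fx ([bseq], b); rewrite face_nil -rowE => /matrixP/(_ 0 0); rewrite !mxE.
Qed.

End PolyhedralNorm.

(** * Stability yields a Lyapunov polynomial *)

Section Necessity.
Variables (R : realType) (n m : nat) (A : 'I_m -> 'M[R]_n).

Let G : set 'M[R]_n := [set M | reachable A 1 M].

(** A finite product is continued by repeating one of its factors, so that it
    lies on a solution defined for all times. *)
Lemma stable_bounded_products : lyapunov_stable A ->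
  exists C, forall s v, all (mem G) s -> `|transport s v| <= C * `|v|.
Proof.
move=> /(_ 1 ltr01) [d d0 stab].
have lt1 s v : all (mem G) s -> s != [::] -> `|v| < d -> `|transport s v| < 1.
  case: s => // M s GMs _ vd.
  have rPhi j : reachable A 1 (nth M (M :: s) j).
    have [js|js] := ltnP j (size (M :: s)).
      by have := mem_nth M js => /(allP GMs); rewrite inE.
    by rewrite nth_default //; move: GMs => /= /andP[+ _]; rewrite inE.
  have [x [xsol x0 xk]] := infinite_trajectory v rPhi.
  rewrite -(mkseq_nth M (M :: s)) -xk; apply: stab => //.
  by rewrite x0.
exists (2 / d + 1) => s v Gs.
have [->|snil] := eqVneq s [::].
  by rewrite /transport /= ler_peMl // lerDr divr_ge0 // ltW.
have [->|v0] := eqVneq v 0; first by rewrite linear0 normr0 mulr0.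
have nv0 : 0 < `|v| by rewrite normr_gt0.
pose a := d / 2 / `|v|.
have a0 : 0 < a by rewrite !divr_gt0.
have av : `|a *: v| < d.
  rewrite normrZ gtr0_norm // /a divfK ?gt_eqF // ltr_pdivrMr //.
  by rewrite ltr_pMr // ltr1n.
have := lt1 s (a *: v) Gs snil av.
rewrite linearZ /= normrZ gtr0_norm // mulrC -ltr_pdivlMr // div1r => lt.
apply: le_trans (ltW lt) _; rewrite /a !invfM !invrK mulrDl mul1r.
by rewrite [d^-1 * 2]mulrC lerDl.
Qed.

Lemma attractive_products_vanish : locally_attractive A ->
  forall (Phi : nat -> 'M[R]_n) v, (forall j, Phi j \in G) ->
  forall e, 0 < e -> exists k, `|transport (mkseq Phi k) v| < e.
Proof.
move=> [d d0 attr] Phi v GPhi e e0.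
pose c := d / (`|v| + 1).
have c0 : 0 < c by rewrite divr_gt0 // ltr_wpDl.
have rPhi j : reachable A 1 (Phi j) by have := GPhi j; rewrite inE.
have [x [xsol x0 xk]] := infinite_trajectory (c *: v) rPhi.
have xd : `|x 0| < d.
  rewrite x0 normrZ ger0_norm ?(ltW c0) // /c mulrAC ltr_pdivrMr ?ltr_wpDl //.
  by rewrite ltr_pM2l // ltrDl.
have := attr x xsol xd; move=> /cvgrPdist_lt /(_ (e * c)); rewrite mulr_gt0 // => /(_ isT).
move=> [B [Breal xB]]; exists (Num.bound `|B|).
have /xB /= : B < (Num.bound `|B|)%:R.
  exact: le_lt_trans (ler_norm _) (archi_boundP (normr_ge0 _)).
rewrite sub0r normrN xk linearZ /= normrZ ger0_norm ?(ltW c0) //.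
by rewrite mulrC ltr_pM2r.
Qed.

Lemma word_product_cat (E : 'I_m -> 'M[R]_n) w1 w2 :
  word_product E (w1 ++ w2) = word_product E w2 *m word_product E w1.
Proof. by elim: w1 => [|i w1 IH] /=; rewrite ?mulmx1 // IH mulmxA. Qed.

Lemma reachable_word h w : 0 <= h -> h <= 1 ->
  reachable A ((size w)%:R * h) (word_product (fun i => expm (A i) h) w).
Proof.
move=> h0 h1; elim: w => [|i w IH] /=; first by rewrite mul0r; exact: reachable0.
rewrite -nat1r mulrDl mul1r; apply: reachable_mul => //; first by rewrite mulr_ge0.
exact: reachable_expm.
Qed.

(** A word over the steps of length [1 / N] is cut into blocks of [N] letters,
    each of which takes unit time. *)
Lemma word_blocks N K w : (0 < N)%N -> size w = (K * N)%N ->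
  exists s, [/\ size s = K, all (mem G) s & forall v,
    transport s v = word_product (fun i => expm (A i) N%:R^-1) w *m v].
Proof.
move=> N0; elim: K w => [|K IH] w sw.
  by exists [::]; split => // v; rewrite (size0nil sw) /= mul1mx.
have Nw : (N <= size w)%N by rewrite sw mulSn leq_addr.
have [|s [sK Gs sv]] := IH (drop N w).
  by rewrite size_drop sw mulSn addKn.
exists (word_product (fun i => expm (A i) N%:R^-1) (take N w) :: s).
split => [|/=|v]; first by rewrite /= sK.
  have N1 : N%:R^-1 <= 1 :> R by rewrite invf_le1 ?ltr0n // ler1n.
  have := @reachable_word N%:R^-1 (take N w) _ N1.
  rewrite invr_ge0 ler0n size_takel // mulfV ?pnatr_eq0 -?lt0n // => /(_ isT).
  by rewrite Gs andbT inE.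
by rewrite -{2}(cat_take_drop N w) word_product_cat -mulmxA -sv.
Qed.

Lemma word_product_bound (E : 'I_m -> 'M[R]_n) b w :
  (forall i, n%:R * `|E i - 1%:M| <= b) -> `|word_product E w| <= (1 + b) ^+ size w.
Proof.
move=> Eb; elim: w => [|i w IH] /=.
  rewrite expr0; apply/mx_norm_leP => // j k; rewrite mxE.
  by case: (j == k); rewrite ?normr1 // normr0.
rewrite -[E i](subrK 1%:M) mulmxDr mulmx1 exprSr mulrDr mulr1 addrC.
apply: le_trans (ler_normD _ _) (lerD IH _).
apply: le_trans (mx_norm_mulmx _ _) _; rewrite mulrAC mulrC.
by apply: ler_pM; rewrite ?mulr_ge0.
Qed.

(** The error of an Euler step is [O(h^2)], whereas the gain per step is
    proportional to [h], since the words that matter have total duration [K]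
    independent of [h]; a small [h = 1 / N] therefore works. *)
Theorem stable_sos_lyapunov : asymptotically_stable A ->
  exists W : mpoly.mpoly n R,
    [/\ homogeneous W,
        sum_of_squares W,
        positive_definite W,
        forall i : 'I_m, sum_of_squares (- lie_derivative (A i) W) &
        forall i : 'I_m, positive_definite (- lie_derivative (A i) W)].
Proof.
move=> [stab attr].
have [C GC] := stable_bounded_products stab.
(* Products below [rho] have rows of absolute sum at most 1/4. *)
have rho0 : 0 < 4^-1 / n.+1%:R :> R by rewrite divr_gt0.
have [K0 K0P] := uniform_contraction GC (attractive_products_vanish attr) rho0.
set rho := 4^-1 / _ in rho0 K0P; set K := K0.+1.
have /choice[c cP] : forall i : 'I_m, exists c : R, 0 <= c /\
    forall t : R, t \in `[0, 1] -> `|expm (A i) t - (1%:M + t *: A i)| <= c * t ^+ 2.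
  by move=> i; have [c c0 cE] := expm_second_order (A i); exists c.
pose cc := \sum_i c i.
have c_ge0 i : 0 <= c i by have [] := cP i.
have cc_ge i : c i <= cc.
  by rewrite /cc (bigD1 i) //= lerDl sumr_ge0.
have cc0 : 0 <= cc by rewrite sumr_ge0.
pose aa := \sum_i `|A i|.
have aa_ge i : `|A i| <= aa.
  by rewrite /aa (bigD1 i) //= lerDl sumr_ge0.
pose beta := n%:R * (cc + aa).
have beta0 : 0 <= beta by rewrite mulr_ge0 // addr_ge0 // sumr_ge0.
(* A bound for all products of duration at most [K], whatever the step:
   [(1 + h beta)^(K / h) <= exp (beta K)]. *)
pose C1 := expR (beta * K%:R).
pose Q := n%:R * (2 * (n%:R * C1 * cc)).
have Q0 : 0 <= Q by rewrite !mulr_ge0 // expR_ge0.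
pose N := Num.bound (2 * K%:R * Q).
have KQ0 : 0 <= 2 * K%:R * Q by apply: mulr_ge0 => //; apply: mulr_ge0.
have QN : 2 * K%:R * Q < N%:R by apply: archi_boundP.
have N0 : 0 < N%:R :> R by apply: le_lt_trans QN.
have N0' : (0 < N)%N by rewrite -(ltr0n R).
pose h : R := N%:R^-1.
have h0 : 0 < h by rewrite invr_gt0.
have h1 : h <= 1 by rewrite invf_le1 // ler1n.
have h01 : h \in `[0, 1] by rewrite in_itv /= h1 ltW.
have hh : h ^+ 2 <= h by rewrite expr2 ler_piMr // ltW.
have Eh i : `|expm (A i) h - (1%:M + h *: A i)| <= cc * h ^+ 2.
  have [_ cE] := cP i; apply: le_trans (cE h h01) _.
  by rewrite ler_wpM2r // exprn_ge0 // ltW.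
apply: (@polyhedral_contraction_lyapunov R n m A h (cc * h ^+ 2) C1
  (fun i => expm (A i) h) (K * N)) => //.
- move=> w wKN; apply: le_trans (@word_product_bound _ (h * beta) w _) _.
    move=> i; rewrite /beta mulrCA ler_wpM2l //.
    have -> : expm (A i) h - 1%:M = (expm (A i) h - (1%:M + h *: A i)) + h *: A i.
      by rewrite opprD addrA subrK.
    apply: le_trans (ler_normD _ _) _; rewrite mulrDr; apply: lerD.
      by apply: le_trans (Eh i) _; rewrite mulrC ler_wpM2r.
    by rewrite normrZ gtr0_norm // ler_wpM2l // ltW.
  have hb0 : 0 <= h * beta by rewrite mulr_ge0 // ltW.
  apply: (@le_trans _ _ ((1 + h * beta) ^+ (K * N))).
    by apply: ler_weXn2l; [rewrite lerDl | exact: ltnW].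
  have -> : C1 = expR (h * beta) ^+ (K * N).
    rewrite -expRM_natl /C1 natrM; congr expR.
    by rewrite -mulrA [N%:R * _]mulrA mulfV ?gt_eqF // mul1r mulrC.
  by rewrite lerXn2r ?nnegrE ?expR_ge0 ?addr_ge0 // expR_ge1Dx.
- move=> w a wKN; have [s [sK Gs sv]] := word_blocks N0' wKN.
  apply: (@le_trans _ _ (\sum_(b < n) rho)); last first.
    rewrite sumr_const card_ord -[rho *+ n]mulr_natr /rho mulrAC -mulrA ler_piMr //.
    by rewrite ler_pdivrMr // mul1r ler_nat.
  apply: ler_sum => b _.
  have -> : word_product (fun i => expm (A i) h) w a b =
      (transport s (delta_mx b 0)) a 0.
    by rewrite sv -colE mxE.
  apply: le_trans (ler_entry_mx_norm _ _ _) _.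
  apply: le_trans (K0P s _ _ Gs) _; first by rewrite sK.
  rewrite ler_piMr ?(ltW rho0) //; apply/mx_norm_leP => // i j; rewrite mxE.
  by case: (_ && _); rewrite ?normr1 // normr0.
- have -> : n%:R * (2 * (n%:R * C1 * (cc * h ^+ 2))) = Q * h ^+ 2.
    by rewrite /Q; ring.
  rewrite natrM mulrA invfM -/h expr2 mulrA ltr_pM2r //.
  by rewrite ltr_pdivrMr // [_^-1 * _]mulrC ltr_pdivlMr ?mulr_gt0 // mulrC.
Qed.

End Necessity.

(** * Absolutely continuous functions with nonpositive derivative *)

Section Cousin.
Variable R : realType.
Implicit Types (Q : R -> Prop) (s t T : R).

(** Cousin's lemma on tagged partitions, in the form of an induction over
    [[0, T]]: a property that every point [c] propagates across a neighbourhood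
    of itself reaches [T]. *)
Lemma cousin_induction Q T : 0 <= T -> Q 0 ->
  (forall c, 0 <= c -> c <= T -> exists2 d, 0 < d &
    forall s t, 0 <= s -> t <= T -> c - d < s -> s <= c -> c <= t -> t < c + d ->
      Q s -> Q t) ->
  Q T.
Proof.
move=> T0 Q0 step.
pose S := [set s | [/\ 0 <= s, s <= T & Q s]].
have S0 : S 0 by [].
have supS : has_sup S.
  by split; [exists 0 | exists T => s [_ sT _]].
pose c := sup S.
have c0 : 0 <= c by apply: ub_le_sup => //; case: supS.
have cT : c <= T by apply: ge_sup; [exists 0 | move=> s []].
have [d d0 cd] := step c c0 cT.
have [s [s0 sT Qs] cs] := sup_adherent d0 supS.
have sc : s <= c by apply: ub_le_sup => //; case: supS.
pose t := Num.min T (c + d / 2).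
have d20 : 0 < d / 2 by rewrite divr_gt0.
have ct : c <= t by rewrite le_min cT lerDl ltW.
have tT : t <= T by rewrite ge_min lexx.
have tcd : t < c + d.
  by rewrite gt_min; apply/orP; right; rewrite ltrD2l ltr_pdivrMr // ltr_pMr // ltr1n.
have Qt : Q t by apply: (cd s t).
have tc : t <= c.
  by apply: ub_le_sup; [case: supS | split => //; exact: le_trans ct].
(* Beyond the supremum [c] one could still advance to [t], unless [c = T]. *)
have [TE|] := leP T (c + d / 2); first by move: Qt; rewrite /t min_l.
move=> /ltW TE; move: tc; rewrite /t min_r // leNgt ltrDl.
by rewrite d20.
Qed.

Lemma sum_disjoint_intervals (U : set R) N (u v : 'I_N -> R) (d : R) :
  measurable U -> (@lebesgue_measure R U < d%:E)%E ->
  (forall k, u k <= v k) -> (forall k, `]u k, v k[ `<=` U) ->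
  trivIset setT (fun k => `]u k, v k[%classic) ->
  \sum_(k < N) (v k - u k) < d.
Proof.
move=> mU Ud uv uvU tuv; rewrite -lte_fin; apply: le_lt_trans Ud.
have -> : (\sum_(k < N) (v k - u k))%:E =
    lebesgue_measure (\big[setU/set0]_(k < N) `]u k, v k[%classic).
  rewrite measure_bigsetU_ord // -sumEFin; apply: eq_bigr => k _.
  have /= := lebesgue_measure_itv `]u k, v k[%R; rewrite lte_fin => ->.
  by case: ltP => // vu; congr EFin; apply/eqP; rewrite subr_eq0 eq_le vu uv.
apply: le_measure; rewrite ?inE //; first exact: bigsetU_measurable.
apply: (@big_ind _ (fun X => X `<=` U)) => [x []|X Y XU YU x [/XU|/YU]|k _] //.
Qed.

Lemma is_derive_bound (f : R -> R) (c d e : R) : 0 < e -> d <= 0 ->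
  is_derive c (1 : R) f d -> exists2 r, 0 < r &
    forall s t, c - r < s -> s <= c -> c <= t -> t < c + r ->
      f t - f s <= e * (t - s).
Proof.
move=> e0 d0 [/cvg_ex[l fl] fd].
have ld : l = d by rewrite -fd; apply/esym/cvg_lim.
move/cvgrPdist_le : fl => /(_ e e0) [r /= r0 rP].
have near h : h != 0 -> `|h| < r -> `|h * d - (f (h + c) - f c)| <= e * `|h|.
  move=> h0 hr; have := rP h; rewrite /= sub0r normrN => /(_ hr h0).
  rewrite ld => H.
  have -> : h * d - (f (h + c) - f c) = h * (d - h^-1 * (f (h + c) - f c)).
    by rewrite mulrBr mulVKf.
  rewrite normrM mulrC ler_wpM2r //.
  by move: H; rewrite /= [h *: 1]mulr1.
exists r => // s t cs sc ct tc.
have up : f t - f c <= e * (t - c).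
  have [->|tne] := eqVneq t c; first by rewrite !subrr mulr0.
  have h0 : 0 <= t - c by rewrite subr_ge0.
  have := near (t - c); rewrite subr_eq0 => /(_ tne).
  rewrite ger0_norm // subrK ltrBlDl => /(_ tc).
  rewrite ler_norml => /andP[+ _]; nra.
have dn : f c - f s <= e * (c - s).
  have [->|sne] := eqVneq s c; first by rewrite !subrr mulr0.
  have h0 : s - c <= 0 by rewrite subr_le0.
  have := near (s - c); rewrite subr_eq0 => /(_ sne).
  rewrite ler0_norm // subrK opprB ltrBlDl -ltrBlDr => /(_ cs).
  rewrite ler_norml => /andP[_ +]; nra.
lra.
Qed.

(** The invariant of the tagged partition: the intervals from [u k] to [v k]
    are those whose tag lies in [U], and [e s] pays for all the others. *)
Definition growth_bound (U : set R) (f : R -> R) (e s : R) : Prop :=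
  exists (N : nat) (u v : nat -> R),
    [/\ forall k, (k < N)%N ->
          [/\ 0 <= u k, u k <= v k, v k <= s & `]u k, v k[ `<=` U],
        forall j k, (j < k)%N -> (k < N)%N -> v j <= u k &
        f s - f 0 <= e * s + \sum_(k < N) `|f (v k) - f (u k)|].

Lemma growth_bound_append U f e s t : 0 <= e -> 0 <= s -> s <= t ->
  `]s, t[ `<=` U -> growth_bound U f e s -> growth_bound U f e t.
Proof.
move=> e0 s0 st stU [N [u [v [uv disj fs]]]].
exists N.+1, (fun k => if (k < N)%N then u k else s),
  (fun k => if (k < N)%N then v k else t); split.
- move=> k kN; case: ifPn => [kN'|_]; last by split.
  by have [u0 uvk vs ukvk] := uv k kN'; split => //; exact: le_trans st.
- move=> j k jk; rewrite ltnS => kN; rewrite (leq_trans jk kN).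
  case: ifPn => [kN'|_]; first exact: disj.
  by have [_ _ + _] := uv j (leq_trans jk kN).
- rewrite big_ord_recr /= ltnn.
  under eq_bigr => k _ do rewrite ltn_ord.
  have := ler_norm (f t - f s); have : e * s <= e * t by rewrite ler_wpM2l.
  lra.
Qed.

(** The times without a nonpositive derivative are covered by an open set [U] of
    small measure.  A gauge of intervals either inside [U] or around times of
    nonpositive derivative gives [growth_bound]; absolute continuity then makes
    the contribution of [U] at most [e]. *)
Theorem ac_nonincreasing (f : R -> R) T : 0 <= T ->
  absolutely_continuous_on 0 T f ->
  {ae @lebesgue_measure R, forall t : R, 0 < t -> t < T ->
     exists2 d, d <= 0 & is_derive t (1 : R) f d} ->
  f T <= f 0.
Proof.
move=> T0 acf [B [mB B0 badB]].
suff bnd e : 0 < e -> f T - f 0 <= e * (T + 1).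
  rewrite leNgt; apply/negP => fT.
  have T1 : 0 < T + 1 by rewrite ltr_wpDl.
  have := bnd ((f T - f 0) / 2 / (T + 1)).
  rewrite divfK ?gt_eqF // !divr_gt0 ?subr_gt0 // => /(_ isT).
  by rewrite ler_pdivlMr // mulr_natr mulr2n gerDl subr_le0 leNgt fT.
move=> e0; have [d d0 acd] := acf e e0.
(* The end points are added because the hypothesis only concerns inner times. *)
pose B' := B `|` ([set 0 : R] `|` [set T]).
have mB' : measurable B' by apply: measurableU => //; exact: measurableU.
have B'0 : lebesgue_measure B' = 0%E.
  have /negligibleP : (@lebesgue_measure R).-negligible B'.
    have n1 (y : R) : (@lebesgue_measure R).-negligible [set y].
      by apply/negligibleP => //; exact: lebesgue_measure_set1.
    by apply: negligibleU; [apply/negligibleP | exact: negligibleU].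
  by apply.
have [U [oU BU Ud]] : exists U : set R,
    [/\ open U, B' `<=` U & (lebesgue_measure (U `\` B') < d%:E)%E].
  apply: lebesgue_regularity_outer => //.
  exact: (eq_ind_r (fun z => z < +oo)%E (ltry 0) B'0).
have mU : measurable U by exact: open_measurable.
have {}Ud : (@lebesgue_measure R U < d%:E)%E.
  have mUB : measurable (U `\` B') by exact: measurableD.
  have := measureU0 (mu := @lebesgue_measure R) mUB mB' B'0; rewrite (setDKU BU) => UE.
  exact: (eq_ind_r (fun z => z < d%:E)%E Ud UE).
have [N [u [v [uv disj fT]]]] : growth_bound U f e T.
  apply: (cousin_induction T0) => [|c c0 cT].
    by exists 0%N, (fun=> 0), (fun=> 0); split => //; rewrite subrr mulr0 add0r big_ord0.
  have [Uc|Uc] := pselect (U c).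
    have [r /= r0 rU] := (nbhs_ballP _ _).1 (open_nbhs_nbhs (conj oU Uc)).
    exists r => // s t s0 tT cs sc ct tc.
    apply: growth_bound_append; rewrite ?(ltW e0) //; first exact: le_trans ct.
    move=> x /=; rewrite in_itv /= => /andP[sx xt]; apply: rU.
    change (`|c - x| < r); rewrite ltr_norml; apply/andP; split; lra.
  have c_gt0 : 0 < c.
    rewrite lt_neqAle c0 andbT; apply/eqP => c0E; apply: Uc; apply: BU.
    by right; left; rewrite /= c0E.
  have c_ltT : c < T.
    rewrite lt_neqAle cT andbT; apply/eqP => cTE; apply: Uc; apply: BU.
    by right; right.
  have [z z0 fz] : exists2 z, z <= 0 & is_derive c (1 : R) f z.
    apply: contrapT => nod; apply: Uc; apply: BU; left; apply: badB => /= H.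
    by apply: nod; exact: H.
  have [r r0 rP] := is_derive_bound e0 z0 fz.
  exists r => // s t s0 tT cs sc ct tc [N [u [v [uv disj fs]]]].
  exists N, u, v; split => //.
    move=> k kN; have [u0 uvk vs ukU] := uv k kN; split => //.
    by rewrite (le_trans vs) // (le_trans sc).
  have := rP s t cs sc ct tc; lra.
have tI : trivIset setT (fun k : 'I_N => `]u k, v k[%classic).
  apply/trivIsetP => j k _ _ jk; apply/seteqP; split => // x [] /=.
  rewrite !in_itv /= => /andP[uj vj] /andP[uk vk].
  move: jk; rewrite neq_ltn => /orP[] /disj /(_ (ltn_ord _)) => h.
    by have := lt_trans (lt_le_trans vj h) uk; rewrite ltxx.
  by have := lt_trans (lt_le_trans vk h) uj; rewrite ltxx.
have uvT (k : 'I_N) : [/\ 0 <= u k, u k <= v k & v k <= T].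
  by have [] := uv k (ltn_ord k).
have := acd N (fun k => u k) (fun k => v k) uvT tI.
have sd : \sum_(k < N) (v k - u k) < d.
  apply: (sum_disjoint_intervals mU Ud) => // k; first by have [] := uvT k.
  by have [] := uv k (ltn_ord k).
move=> /(_ sd) => se; rewrite mulrDr mulr1; apply: le_trans fT _.
by rewrite lerD2l ltW.
Qed.

End Cousin.

(** * Polynomial functions along absolutely continuous curves *)

Section PolynomialCalculus.
Variables (R : realType) (n : nat).
Implicit Types (p : mpoly.mpoly n R) (x y : 'cV[R]_n).

Definition value p x : R := mpoly.meval (fun k => x k 0) p.

Lemma value_lipschitz p B : 0 <= B -> exists2 L, 0 <= L &
  forall x y, `|x| <= B -> `|y| <= B -> `|value p x - value p y| <= L * `|x - y|.
Proof.
move=> B0; elim/Forms.mpoly_alg_ind: p => [c|k|p q [L L0 pL] [K K0 qK]|p q [L L0 pL] [K K0 qK]].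
- by exists 0 => // x y _ _; rewrite /value !mpoly.mevalC subrr normr0 mul0r.
- exists 1 => // x y _ _; rewrite /value !mpoly.mevalXU mul1r.
  by have := ler_entry_mx_norm (x - y) k 0; rewrite !mxE.
- exists (L + K) => [|x y xB yB]; first exact: addr_ge0.
  rewrite /value !mpoly.mevalD opprD addrACA mulrDl.
  apply: le_trans (ler_normD _ _) _; apply: lerD; [exact: pL | exact: qK].
have bnd r M : 0 <= M -> (forall x y, `|x| <= B -> `|y| <= B ->
    `|value r x - value r y| <= M * `|x - y|) ->
    forall x, `|x| <= B -> `|value r x| <= `|value r 0| + M * B.
  move=> M0 rM x xB; have := ler_normD (value r x - value r 0) (value r 0).
  rewrite subrK => /le_trans; apply; rewrite addrC lerD2l.
  have := rM x 0 xB; rewrite normr0 subr0 => /(_ B0) /le_trans; apply.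
  by rewrite ler_wpM2l.
pose bp := `|value p 0| + L * B; pose bq := `|value q 0| + K * B.
have bp0 : 0 <= bp by rewrite addr_ge0 // mulr_ge0.
have bq0 : 0 <= bq by rewrite addr_ge0 // mulr_ge0.
exists (L * bq + bp * K) => [|x y xB yB]; first by rewrite addr_ge0 // mulr_ge0.
have -> : value (p * q) x - value (p * q) y =
    (value p x - value p y) * value q x + value p y * (value q x - value q y).
  by rewrite /value !mpoly.mevalM; ring.
rewrite [leRHS]mulrDl; apply: le_trans (ler_normD _ _) _; apply: lerD; rewrite normrM.
  rewrite mulrAC; apply: ler_pM => //; first exact: pL.
  exact: (bnd q K).
rewrite -mulrA; apply: ler_pM => //; last exact: qK.
exact: (bnd p L).
Qed.

Lemma is_derive_value p (x : R -> 'cV[R]_n) (t : R) (D : 'cV[R]_n) :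
  is_derive t (1 : R) x D ->
  is_derive t (1 : R) (fun s => value p (x s))
    (\sum_(k < n) value (mpoly.mderiv k p) (x t) * D k 0).
Proof.
move=> xD; elim/Forms.mpoly_alg_ind: p => [c|k|p q pD qD|p q pD qD].
- have -> : (fun s => value (mpoly.mpolyC n c) (x s)) = cst c.
    by apply/funext => s; rewrite /value mpoly.mevalC.
  rewrite big1 => [|k _]; first exact: is_derive_cst.
  by rewrite mpoly.mderivC /value mpoly.meval0 mul0r.
- have -> : (fun s => value (mpoly.mpolyX R (mpoly.mnm1 k)) (x s)) = (fun s => x s k 0).
    by apply/funext => s; rewrite /value mpoly.mevalXU.
  rewrite (bigD1 k) //= big1 => [|j jk]; last first.
    by rewrite Forms.mderivXU eq_sym (negbTE jk) /value mpoly.mevalC mul0r.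
  rewrite Forms.mderivXU eqxx /value mpoly.mevalC mul1r addr0.
  exact: is_derive_entry.
- have -> : (fun s => value (p + q) (x s)) =
     (fun s => value p (x s)) + (fun s => value q (x s)).
    by apply/funext => s; rewrite /value mpoly.mevalD.
  have -> : \sum_(k < n) value (mpoly.mderiv k (p + q)) (x t) * D k 0 =
     \sum_(k < n) value (mpoly.mderiv k p) (x t) * D k 0 +
     \sum_(k < n) value (mpoly.mderiv k q) (x t) * D k 0.
    rewrite -big_split; apply: eq_bigr => k _.
    by rewrite mpoly.mderivD /value mpoly.mevalD mulrDl.
  exact: is_deriveD.
have -> : (fun s => value (p * q) (x s)) =
   (fun s => value p (x s)) * (fun s => value q (x s)).
  by apply/funext => s; rewrite /value mpoly.mevalM.
have -> : \sum_(k < n) value (mpoly.mderiv k (p * q)) (x t) * D k 0 =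
   value p (x t) *: (\sum_(k < n) value (mpoly.mderiv k q) (x t) * D k 0) +
   value q (x t) *: (\sum_(k < n) value (mpoly.mderiv k p) (x t) * D k 0).
  rewrite !scaler_sumr -big_split; apply: eq_bigr => k _.
  rewrite mpoly.mderivM /value mpoly.mevalD !mpoly.mevalM.
  by rewrite -[RHS]/(_ * (_ * _) + _ * (_ * _)); ring.
exact: is_deriveM.
Qed.

Lemma mx_norm_trmx (y : 'rV[R]_n) : `|y^T| = `|y|.
Proof.
apply/eqP; rewrite eq_le; apply/andP; split; apply/mx_norm_leP => // i j.
  by rewrite mxE ler_entry_mx_norm.
by have := ler_entry_mx_norm y^T j i; rewrite mxE.
Qed.

(** The minimum is attained, and positive, because the unit sphere is compact. *)
Lemma value_sphere_lower_bound p : positive_definite p ->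
  exists2 c, 0 < c & forall x, `|x| = 1 -> c <= value p x.
Proof.
move=> pd; pose A := [set y : 'rV[R]_n | `|y| = 1].
have [A0|noA] := pselect (A !=set0); last first.
  by exists 1 => // x x1; case: noA; exists x^T; rewrite /A /= -mx_norm_trmx trmxK.
have [L L0 pL] := value_lipschitz p (ler0n R 2).
have cA : compact A.
  apply: bounded_closed_compact.
    exists 1; split; first exact: num_real.
    by move=> M M1 y /= ->; exact: ltW.
  have -> : A = (fun y : 'rV[R]_n => `|y|) @^-1` [set 1] by [].
  apply: (continuous_closedP _).1; last exact: closed_eq.
  exact: norm_continuous.
have cp : {within A, continuous (fun y : 'rV[R]_n => value p y^T)}.
  apply: continuous_in_subspaceT => y /[!inE] y1; rewrite /A in y1.
  apply: (cvgrPdist_le (FF := nbhs_filter y) _ _).2 => e e0.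
  have r0 : 0 < Num.min 1 (e / (L + 1)).
    by rewrite lt_min ltr01 divr_gt0 // ltr_wpDl.
  apply: filterS (nbhsx_ballx y _ r0) => z.
  rewrite -ball_normE /= => /ltW zy.
  move: zy; rewrite le_min => /andP[zy1 zye].
  have z2 : `|z| <= 2.
    have := ler_normD y (z - y); rewrite addrC subrK y1 distrC; lra.
  have := pL y^T z^T; rewrite -linearB /= !mx_norm_trmx y1 => /(_ _ z2) /le_trans.
  apply; first by lra.
  move: zye; rewrite ler_pdivlMr ?ltr_wpDl // => zye.
  have := normr_ge0 (y - z); nra.
have [y yA ymin] := compact_EVT_min A0 cA cp.
exists (value p y^T).
  apply: pd; apply/eqP => y0; move: yA; rewrite inE /A /= -mx_norm_trmx y0 normr0.
  by move=> /esym/eqP; rewrite oner_eq0.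
move=> x x1; have := ymin x^T; rewrite trmxK; apply.
by rewrite inE /A /= -mx_norm_trmx trmxK.
Qed.

Variable d : nat.
Hypothesis d_gt0 : (0 < d)%N.

Lemma value_normalize p x : Forms.form_of_degree d p ->
  value p x = `|x| ^+ d * value p (`|x|^-1 *: x).
Proof.
move=> hp; have [->|x0] := eqVneq x 0; last first.
  have nx0 : `|x| != 0 by rewrite normr_eq0.
  by rewrite /value -(Forms.dhomog_mevalZ _ _ hp) scalerA mulfV // scale1r.
rewrite normr0 expr0n gtn_eqF // mul0r -[X in value p X](scale0r (0 : 'cV[R]_n)).
by rewrite /value (Forms.dhomog_mevalZ _ _ hp) expr0n gtn_eqF // mul0r.
Qed.

Lemma normalize_norm x : x != 0 -> `| `|x|^-1 *: x| = 1.
Proof.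
by move=> x0; rewrite normrZ normfV normr_id mulVf // normr_eq0.
Qed.

Lemma form_lower_bound p : Forms.form_of_degree d p -> positive_definite p ->
  exists2 c, 0 < c & forall x, c * `|x| ^+ d <= value p x.
Proof.
move=> hp /value_sphere_lower_bound[c c0 cp]; exists c => // x.
rewrite (value_normalize x hp) mulrC.
have [->|x0] := eqVneq x 0; first by rewrite normr0 expr0n gtn_eqF // !mul0r.
by rewrite ler_wpM2l ?exprn_ge0 // cp // normalize_norm.
Qed.

Lemma form_upper_bound p : Forms.form_of_degree d p ->
  exists2 C, 0 < C & forall x, value p x <= C * `|x| ^+ d.
Proof.
move=> hp; have [L L0 pL] := value_lipschitz p (ler01 : 0 <= (1 : R)).
exists (`|value p 0| + L + 1) => [|x]; first by rewrite ltr_wpDl // addr_ge0.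
rewrite (value_normalize x hp) mulrC.
have [->|x0] := eqVneq x 0; first by rewrite normr0 expr0n gtn_eqF // !mulr0.
rewrite ler_wpM2r ?exprn_ge0 //; set u := _ *: x.
have u1 : `|u| = 1 by exact: normalize_norm.
have := pL u 0; rewrite u1 normr0 subr0 u1 mulr1 => /(_ (lexx _) ler01).
rewrite ler_norml => /andP[_ h]; have := ler_norm (value p 0); lra.
Qed.

End PolynomialCalculus.

Section AbsoluteContinuity.
Variables (R : realType) (V : normedModType R) (x : R -> V) (T : R).
Hypotheses (T0 : 0 <= T) (acx : absolutely_continuous_on 0 T x).

Lemma ac_uniform e : 0 < e -> exists2 d, 0 < d &
  forall u v, 0 <= u -> u <= v -> v <= T -> v - u < d -> `|x v - x u| < e.
Proof.
move=> /acx[d d0 xd]; exists d => // u v u0 uv vT uvd.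
have := xd 1%N (fun=> u) (fun=> v); rewrite !big_ord1; apply => //.
by apply/trivIsetP => i j _ _; rewrite !ord1 eqxx.
Qed.

Lemma ac_bounded : exists2 B, 0 <= B &
  forall t, 0 <= t -> t <= T -> `|x t| <= B.
Proof.
have [d d0 xd] := ac_uniform ltr01.
pose Q s := exists2 B, 0 <= B & forall t, 0 <= t -> t <= s -> `|x t| <= B.
apply: (@cousin_induction R Q T T0).
  exists `|x 0| => // t t0 t0'; suff -> : t = 0 by [].
  by apply/eqP; rewrite eq_le t0 t0'.
move=> c c0 cT; exists (d / 2); first by rewrite divr_gt0.
move=> s t s0 tT cs sc ct tc [B B0 xB]; exists (B + 1) => [|r r0 rt].
  by rewrite addr_ge0.
have [rs|sr] := leP r s.
  by apply: le_trans (xB r r0 rs) _; rewrite lerDl.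
have := xd s r s0 (ltW sr) (le_trans rt tT).
have -> : r - s < d by lra.
move=> /(_ isT) h; have := ler_normD (x r - x s) (x s); rewrite subrK.
have := xB s s0 (lexx _); lra.
Qed.

Lemma ac_comp (f : R -> R) K : 0 <= K ->
  (forall u v, 0 <= u -> u <= v -> v <= T ->
     `|f v - f u| <= K * ((v - u) + `|x v - x u|)) ->
  absolutely_continuous_on 0 T f.
Proof.
move=> K0 fK e e0.
have e' : 0 < e / 2 / (K + 1) by rewrite !divr_gt0 // ltr_wpDl.
have [d d0 xd] := acx e'.
exists (Num.min d (e / 2 / (K + 1))) => [|N u v uv tI]; first by rewrite lt_min d0.
rewrite lt_min => /andP[sd se]; have xe := xd N u v uv tI sd.
apply: (@le_lt_trans _ _
  (K * (\sum_(k < N) (v k - u k) + \sum_(k < N) `|x (v k) - x (u k)|))).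
  rewrite -big_split mulr_sumr; apply: ler_sum => k _.
  by have [u0 uvk vT] := uv k; exact: fK.
move: se xe; rewrite !ltr_pdivlMr ?ltr_wpDl //.
have : 0 <= \sum_(k < N) (v k - u k).
  by apply: sumr_ge0 => k _; have [_ uvk _] := uv k; rewrite subr_ge0.
have : 0 <= \sum_(k < N) `|x (v k) - x (u k)| by rewrite sumr_ge0.
nra.
Qed.

End AbsoluteContinuity.

(** * A Lyapunov polynomial yields stability *)

Section Sufficiency.
Variables (R : realType) (n m : nat) (A : 'I_m -> 'M[R]_n).

Lemma value_lie_derivative_hull B (W : mpoly.mpoly n R) (k : R) (y : 'cV[R]_n) :
  matrix_convex_hull A B ->
  (forall i, k <= value (- lie_derivative (A i) W) y) ->
  value (lie_derivative B W) y <= - k.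
Proof.
move=> [c [c0 c1 ->]] kA.
have -> : value (lie_derivative (\sum_i c i *: A i) W) y =
    \sum_i c i * value (lie_derivative (A i) W) y.
  rewrite /value Forms.lie_derivative_eval.
  under [RHS]eq_bigr do rewrite Forms.lie_derivative_eval mulr_sumr.
  rewrite exchange_big; apply: eq_bigr => j _.
  rewrite mulmx_suml summxE mulr_sumr; apply: eq_bigr => i _.
  by rewrite -scalemxAl mxE mulrCA.
rewrite -[k]mul1r -c1 mulr_suml -sumrN; apply: ler_sum => i _.
rewrite -mulrN ler_wpM2l //; have := kA i.
by rewrite /value mpoly.mevalN lerNr.
Qed.

(** The factor [1 + lambda t] integrates [V' <= - lambda V] only up to
    algebraic decay, which is enough for attractivity, and it is a polynomial. *)
Lemma solution_decay (W : mpoly.mpoly n R) lambda x T :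
  0 <= lambda -> 0 <= T -> (forall y, 0 <= value W y) ->
  (forall B y, matrix_convex_hull A B ->
     value (lie_derivative B W) y <= - (lambda * value W y)) ->
  inclusion_solution A x ->
  (1 + lambda * T) * value W (x T) <= value W (x 0).
Proof.
move=> l0 T0 W0 WB [acx dx].
have [->|Tne] := eqVneq T 0; first by rewrite mulr0 addr0 mul1r.
have T_gt0 : 0 < T by rewrite lt_neqAle eq_sym Tne.
have {}acx := acx T T_gt0.
(* Its derivative is at most
   [lambda W - (1 + lambda t) lambda W = - lambda^2 t W <= 0]. *)
pose f t := (1 + lambda * t) * value W (x t).
suff : f T <= f 0 by rewrite /f mulr0 addr0 mul1r.
have [b b0 xb] := ac_bounded T0 acx.
have [L L0 WL] := value_lipschitz W b0.
have bW t : 0 <= t -> t <= T -> value W (x t) <= value W 0 + L * b.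
  move=> t0 tT; have := WL (x t) 0 (xb t t0 tT); rewrite normr0 subr0 => /(_ b0).
  rewrite ler_norml => /andP[_ h]; have := ler_wpM2l L0 (xb t t0 tT); lra.
have bW0 : 0 <= value W 0 + L * b by rewrite addr_ge0 // mulr_ge0.
apply: ac_nonincreasing => //.
  apply: (@ac_comp _ _ x T acx f (lambda * (value W 0 + L * b) + (1 + lambda * T) * L)).
    by rewrite addr_ge0 ?mulr_ge0 // addr_ge0 // mulr_ge0.
  move=> u v u0 uv vT.
  have v0 := le_trans u0 uv; have uT := le_trans uv vT.
  have -> : f v - f u = lambda * (v - u) * value W (x u)
      + (1 + lambda * v) * (value W (x v) - value W (x u)).
    by rewrite /f; ring.
  apply: le_trans (ler_normD _ _) _; rewrite !normrM.
  rewrite (ger0_norm l0) (ger0_norm (_ : 0 <= v - u)) ?subr_ge0 //.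
  rewrite (ger0_norm (W0 _)) (ger0_norm (_ : 0 <= 1 + lambda * v)) ?addr_ge0 ?mulr_ge0 //.
  have h1 : lambda * (v - u) * value W (x u) <=
      lambda * (value W 0 + L * b) * (v - u).
    rewrite mulrAC ler_wpM2r ?subr_ge0 // ler_wpM2l //; exact: bW.
  have h2 : (1 + lambda * v) * `|value W (x v) - value W (x u)| <=
      (1 + lambda * T) * L * `|x v - x u|.
    rewrite -mulrA; apply: ler_pM => //; first by rewrite addr_ge0 // mulr_ge0.
      by rewrite lerD2l ler_wpM2l.
    by apply: WL; exact: xb.
  have h3 : 0 <= (1 + lambda * T) * L * (v - u).
    by rewrite !mulr_ge0 ?subr_ge0 // addr_ge0 // mulr_ge0.
  have h4 : 0 <= lambda * (value W 0 + L * b) * `|x v - x u|.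
    by rewrite !mulr_ge0.
  rewrite mulrDl !mulrDr; lra.
apply: negligibleS dx => t /= + xt; apply => t0 tT; have [B AB xB] := xt t0.
exists (lambda * value W (x t) + (1 + lambda * t) * value (lie_derivative B W) (x t)).
  have := WB B (x t) AB; have := W0 (x t) => w0 wB.
  have : (1 + lambda * t) * value (lie_derivative B W) (x t) <=
      (1 + lambda * t) * - (lambda * value W (x t)).
    by rewrite ler_wpM2l // addr_ge0 // mulr_ge0 // ltW.
  move=> h; apply: le_trans (lerD (lexx _) h) _.
  have : 0 <= lambda * t * (lambda * value W (x t)) by rewrite !mulr_ge0 // ltW.
  lra.
have dW := is_derive_value W xB.
rewrite -Forms.lie_derivative_eval in dW.
have -> : f = (cst 1 + lambda \*: id) * (fun s => value W (x s)).
  by apply/funext => s.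
have dl : is_derive t (1 : R) (cst 1 + lambda \*: id) (0 + lambda *: (1 : R)).
  exact: is_deriveD.
have -> : lambda * value W (x t) + (1 + lambda * t) * value (lie_derivative B W) (x t) =
    (cst 1 + lambda \*: id) t *: value (lie_derivative B W) (x t)
    + value W (x t) *: (0 + lambda *: (1 : R)).
  rewrite -[RHS]/((1 + lambda * t) * value (lie_derivative B W) (x t) +
    value W (x t) * (0 + lambda * 1)); ring.
exact: is_deriveM.
Qed.

(** Without modes the convex hull is empty, so a solution exists only if almost
    no time is positive; the identity would then satisfy the condition on its
    derivative vacuously and be nonincreasing. *)
Lemma no_mode_no_solution x : m = 0%N -> ~ inclusion_solution A x.
Proof.
move=> m0 [_ dx].
have acid : absolutely_continuous_on 0 1 (id : R -> R).
  move=> e e0; exists e => // N u v uv _.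
  rewrite [X in _ -> X < e](eq_bigr (fun k => v k - u k)) // => k _.
  by have [_ uvk _] := uv k; rewrite ger0_norm // subr_ge0.
have := ac_nonincreasing ler01 acid; rewrite /= leNgt ltr01 => H.
suff : ~~ true by []; apply: H.
apply: negligibleS dx => t /= + xt; apply => t0 _; have [B [c [_ c1 _]] _] := xt t0.
have : \sum_(i < m) c i = 0 by rewrite big1 // => -[i im]; exfalso; rewrite m0 in im.
by rewrite c1 => /eqP; rewrite oner_eq0.
Qed.

Lemma algebraic_decay_stable D (r lambda : R) : (0 < D)%N -> 0 < r -> 0 < lambda ->
  (forall x T, 0 <= T -> inclusion_solution A x ->
     r * (1 + lambda * T) * `|x T| ^+ D <= `|x 0| ^+ D) ->
  asymptotically_stable A.
Proof.
move=> D0 r0 l0 decay; split.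
  move=> e e0; pose q := Num.min 1 r.
  have q0 : 0 < q by rewrite lt_min ltr01.
  exists (e * q) => [|x xsol x0 t t0]; first exact: mulr_gt0.
  have xt := decay x t t0 xsol; rewrite ltNge; apply/negP => ext.
  have h1 : `|x 0| ^+ D < (e * q) ^+ D by rewrite ltrXn2r // -lt0n.
  have h2 : (e * q) ^+ D <= r * e ^+ D.
    rewrite exprMn mulrC ler_wpM2r ?exprn_ge0 ?(ltW e0) //.
    have q1 : q <= 1 by rewrite ge_min lexx.
    apply: le_trans (ler_iXnr D0 (ltW q0) q1) _.
    by rewrite ge_min lexx orbT.
  have h3 : e ^+ D <= `|x t| ^+ D by rewrite lerXn2r ?nnegrE ?(ltW e0).
  have h4 : r * e ^+ D <= r * (1 + lambda * t) * `|x t| ^+ D.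
    apply: ler_pM => //; rewrite ?exprn_ge0 ?(ltW r0) ?(ltW e0) //.
    by rewrite ler_peMr ?(ltW r0) // lerDl mulr_ge0 // ltW.
  by have := lt_le_trans (le_lt_trans (le_trans h4 xt) h1) h2; rewrite ltxx.
exists 1 => // x xsol x0; apply/cvgrPdist_lt => e e0.
have eD0 : 0 < e ^+ D by rewrite exprn_gt0.
exists (lambda * r * e ^+ D)^-1; split; first exact: num_real.
move=> t /= te; rewrite sub0r normrN ltNge; apply/negP => ext.
have t0 : 0 < t by apply: lt_trans te; rewrite invr_gt0 !mulr_gt0.
have xt := decay x t (ltW t0) xsol.
have h1 : `|x 0| ^+ D <= 1 by rewrite expr_le1 // ltW.
have h3 : e ^+ D <= `|x t| ^+ D by rewrite lerXn2r ?nnegrE ?(ltW e0).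
have h4 : r * (1 + lambda * t) * e ^+ D <= r * (1 + lambda * t) * `|x t| ^+ D.
  rewrite ler_wpM2l // mulr_ge0 ?(ltW r0) // addr_ge0 // mulr_ge0 //; exact: ltW.
move: te; rewrite -div1r ltr_pdivrMr ?mulr_gt0 // => te.
have h5 : 0 < r * e ^+ D by rewrite mulr_gt0.
have := le_trans h4 (le_trans xt h1); lra.
Qed.

(** All the forms involved are bounded above and below by multiples of
    [|x|^d]; the reciprocal [kappa] of a sum of reciprocals is a positive lower
    bound for the finitely many constants [k i]. *)
Theorem polynomial_lyapunov_stable (W : mpoly.mpoly n R) :
  homogeneous W -> positive_definite W ->
  (forall i, positive_definite (- lie_derivative (A i) W)) ->
  asymptotically_stable A.
Proof.
move=> [d hW] pdW pdA.
have [n0|n0] := posnP n.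
  have z (y : 'cV[R]_n) : y = 0.
    by apply/matrixP => -[i lti]; exfalso; rewrite n0 in lti.
  apply: (@algebraic_decay_stable 1 1 1) => // x T _ _.
  by rewrite (z (x T)) (z (x 0)) normr0 expr0n mulr0.
have [m0|m0] := posnP m.
  apply: (@algebraic_decay_stable 1 1 1) => // x T _ xsol.
  by case: (no_mode_no_solution m0 xsol).
have d0 : (0 < d)%N.
  rewrite lt0n; apply/eqP => dE; rewrite dE in hW.
  have := pdA (Ordinal m0) (const_mx 1).
  rewrite (Forms.lie_derivative_homog0 _ hW) oppr0 mpoly.meval0 ltxx.
  move=> /(_ _)/negP; apply => //; apply/eqP => /matrixP/(_ (Ordinal n0) 0)/eqP.
  by rewrite !mxE oner_eq0.
have [c c0 cW] := form_lower_bound d0 hW pdW.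
have [C C0 WC] := form_upper_bound d0 hW.
have /choice[k kP] : forall i, exists k, 0 < k /\
    forall y, k * `|y| ^+ d <= value (- lie_derivative (A i) W) y.
  move=> i; have hA : Forms.form_of_degree d (- lie_derivative (A i) W).
    by rewrite /Forms.form_of_degree rpredN; exact: Forms.lie_derivative_homog.
  by have [k k0 kA] := form_lower_bound d0 hA (pdA i); exists k.
pose kappa := (1 + \sum_i (k i)^-1)^-1.
have sum0 : 0 <= \sum_i (k i)^-1.
  by apply: sumr_ge0 => i _; rewrite invr_ge0 ltW //; have [] := kP i.
have kappa0 : 0 < kappa by rewrite invr_gt0 ltr_wpDr.
have kappa_le i : kappa <= k i.
  have [k0 _] := kP i; rewrite -[k i]invrK lef_pV2 ?posrE ?invr_gt0 // ?ltr_wpDr //.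
  rewrite (bigD1 i) //= addrCA lerDl addr_ge0 //.
  by apply: sumr_ge0 => j _; rewrite invr_ge0 ltW //; have [] := kP j.
apply: (@algebraic_decay_stable d (c / C) (kappa / C)); rewrite ?divr_gt0 //.
move=> x T T0 xsol.
have W0 y : 0 <= value W y by apply: le_trans (cW y); rewrite mulr_ge0 ?exprn_ge0 // ltW.
have kC : 0 <= kappa / C by rewrite divr_ge0 // ltW.
have := @solution_decay W (kappa / C) x T kC T0 W0 _ xsol.
have WB B y : matrix_convex_hull A B ->
    value (lie_derivative B W) y <= - (kappa / C * value W y).
  move=> AB; apply: (value_lie_derivative_hull AB) => i.
  have [_ kA] := kP i; apply: le_trans (kA y).
  apply: (@le_trans _ _ (kappa * `|y| ^+ d)); last by rewrite ler_wpM2r ?exprn_ge0.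
  by rewrite -mulrA ler_wpM2l ?(ltW kappa0) // mulrC ler_pdivrMr // mulrC.
move=> /(_ WB) dec.
have l1 : 0 <= 1 + kappa / C * T by rewrite addr_ge0 // mulr_ge0.
have := le_trans (ler_wpM2l l1 (cW (x T))) (le_trans dec (WC (x 0))).
rewrite -ler_pdivrMl // => h; apply: le_trans h.
by rewrite le_eqVlt; apply/orP; left; apply/eqP; ring.
Qed.

End Sufficiency.

Theorem theorem4p11 (R : realType) (n m : nat) (A : 'I_m -> 'M[R]_n) :
  asymptotically_stable A <->
  exists W : mpoly.mpoly n R,
    [/\ homogeneous W,
        sum_of_squares W,
        positive_definite W,
        forall i : 'I_m, sum_of_squares (- lie_derivative (A i) W) &
        forall i : 'I_m, positive_definite (- lie_derivative (A i) W)].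
Proof.
split; first exact: stable_sos_lyapunov.
move=> [W [homW _ pdW _ pdA]].
exact: polynomial_lyapunov_stable homW pdW pdA.
Qed.
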